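(* For every finite $m\geq 1$, the tree $\mathcal{A}_{m+1}=[m+1:\omega]$ satisfies $\operatorname{pSR}(\mathcal{A}_{m+1})=2m+1$.
   Context: Trees. A tree is a structure $(T,\prec)$ in the language $\{\prec\}$ where $\prec$ is a strict partial order, the predecessors of each element form a finite linearly ordered set, and there is a $\prec$-least element, the root; trees are countable and have no infinite paths. The level of $x$ is its number of predecessors. Rank: terminal nodes have rank $0$, $\mathrm{rk}(x)=\sup\{\mathrm{rk}(y)+1: y$ an immediate successor of $x\}$, and the rank of $T$ is that of its root. For finite $n\geq1$ and $N\in\omega\cup\{\omega\}$ the tree type $[n:N]$ is defined inductively: $[1:N]$ is the tree of rank $\leq1$ whose root has exactly $N$ children; $[n:N]$ ($n\geq 2$) is the tree of rank $n$ in which exactly $N$ level-one nodes are roots of subtrees of type $[n-1:\omega]$, for every $k\in\omega$ (including $k=0$) infinitely many level-one nodes are roots of subtrees of type $[n-1:k]$, and there are no other level-one nodes. (''$\omega$ many'' and ''infinitely many'' mean countably infinitely many.) Infinitary formulas: $\Sigma^{\mathrm{in}}_0=\Pi^{\mathrm{in}}_0$ are the finitary quantifier-free formulas; for $\alpha\geq1$, a $\Sigma^{\mathrm{in}}_\alpha$ formula is a countable disjunction of formulas $\exists\bar y\,\psi$ with $\psi\in\Pi^{\mathrm{in}}_\beta$, $\beta<\alpha$, and dually $\Pi^{\mathrm{in}}_\alpha$ (countable conjunctions of $\forall\bar y\,\psi$, $\psi\in\Sigma^{\mathrm{in}}_\beta$, $\beta<\alpha$). $\operatorname{SR}(\mathcal{M})$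 is the least $\alpha$ such that every automorphism orbit of every finite tuple of $\mathcal{M}$ is definable by a $\Sigma^{\mathrm{in}}_\alpha$ formula in the language of $\mathcal{M}$ without further parameters. $\operatorname{pSR}(\mathcal{A})$ is the least value of $\operatorname{SR}((\mathcal{A},\bar p))$ over finite tuples $\bar p$ from $\mathcal{A}$, where $(\mathcal{A},\bar p)$ is the expansion by constants naming $\bar p$. *)

(* Defs.v *)
From mathcomp Require Import all_boot all_classical.

Set Implicit Arguments.
Unset Strict Implicit.
Unset Printing Implicit Defensive.

Local Open Scope classical_set_scope.
Local Open Scope card_scope.

(* [osup f] is the least ordinal strictly above every [f i].  An ordinal has
   many representations, so ordinals are compared with [ole], [olt], [oeq],
   never with [=]. *)
Inductive ord : Type := osup (A : Type) (f : A -> ord).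

Fixpoint ole (a b : ord) : Prop :=
  match a with osup A f => forall i,
    match b with osup B g => exists j, ole (f i) (g j) end
  end.

Definition olt (a b : ord) : Prop :=
  match b with osup B g => exists j, ole a (g j) end.

Definition oeq (a b : ord) : Prop := ole a b /\ ole b a.

Fixpoint onat (n : nat) : ord :=
  match n with
  | 0 => osup (False_rect ord)
  | n'.+1 => osup (fun _ : unit => onat n')
  end.

Record language := Language { rsym : Type; arity : rsym -> nat; csym : Type }.

Record structure (L : language) := Structure {
  carrier :> Type;
  rinterp : forall r : rsym L, (arity r).-tuple carrier -> Prop;
  cinterp : csym L -> carrier }.

Inductive term (L : language) (n : nat) :=
| Var of 'I_n
| Cst of csym L.
Arguments Var {L n} _.
Arguments Cst {L n} _.

Inductive qf (L : language) (n : nat) :=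
| QTrue
| QEq of term L n & term L n
| QRel (r : rsym L) of (arity r).-tuple (term L n)
| QNot of qf L n
| QAnd of qf L n & qf L n
| QOr of qf L n & qf L n.
Arguments QTrue {L n}.

(* Formulas with free variables among n.  [OrEx psi] is the disjunction over
   i of "exists (k i) new variables, psi i", and [AndAll psi] the dual; the
   new variables come after the n old ones.  A finite disjunction is coded by
   repeating a disjunct, and the empty one by repeating a false one. *)
Inductive formula (L : language) (n : nat) : Type :=
| Qf of qf L n
| OrEx (k : nat -> nat) of (forall i, formula L (n + k i))
| AndAll (k : nat -> nat) of (forall i, formula L (n + k i)).

Section Satisfaction.
Variables (L : language) (M : structure L).

Definition eval n (x : n.-tuple M) (t : term L n) : M :=
  match t with Var i => tnth x i | Cst c => cinterp M c end.

Fixpoint qf_sat n (x : n.-tuple M) (q : qf L n) : Prop :=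
  match q with
  | QTrue => True
  | QEq s t => eval x s = eval x t
  | QRel r t => @rinterp L M r [tuple of map (eval x) t]
  | QNot p => ~ qf_sat x p
  | QAnd p q => qf_sat x p /\ qf_sat x q
  | QOr p q => qf_sat x p \/ qf_sat x q
  end.

Fixpoint sat n (phi : formula L n) : n.-tuple M -> Prop :=
  match phi with
  | Qf q => fun x => qf_sat x q
  | OrEx k psi => fun x =>
      exists i (y : (k i).-tuple M), sat (psi i) [tuple of x ++ y]
  | AndAll k psi => fun x =>
      forall i (y : (k i).-tuple M), sat (psi i) [tuple of x ++ y]
  end.

End Satisfaction.

Inductive is_Sigma (L : language) : ord -> forall n, formula L n -> Prop :=
| Sigma_qf (a : ord) n (q : qf L n) : oeq a (onat 0) -> is_Sigma a (Qf q)
| Sigma_or (a : ord) n (k : nat -> nat)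
    (psi : forall i, formula L (n + k i)) (b : nat -> ord) :
    (forall i, olt (b i) a) -> (forall i, is_Pi (b i) (psi i)) ->
    is_Sigma a (OrEx psi)
with is_Pi (L : language) : ord -> forall n, formula L n -> Prop :=
| Pi_qf (a : ord) n (q : qf L n) : oeq a (onat 0) -> is_Pi a (Qf q)
| Pi_and (a : ord) n (k : nat -> nat)
    (psi : forall i, formula L (n + k i)) (b : nat -> ord) :
    (forall i, olt (b i) a) -> (forall i, is_Sigma (b i) (psi i)) ->
    is_Pi a (AndAll psi).

Definition automorphism (L : language) (M : structure L) (f : M -> M) : Prop :=
  [/\ bijective f,
      forall (r : rsym L) (t : (arity r).-tuple M),
        @rinterp L M r [tuple of map f t] <-> @rinterp L M r t
    & forall c : csym L, f (cinterp M c) = cinterp M c].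

Definition aut_orbit (L : language) (M : structure L) n (x : n.-tuple M) :
    set (n.-tuple M) :=
  [set y | exists2 f, automorphism f & y = [tuple of map f x]].

Definition Sigma_definable (L : language) (M : structure L) (a : ord) n
    (X : set (n.-tuple M)) : Prop :=
  exists2 phi : formula L n, is_Sigma a phi & forall x, sat phi x <-> X x.

Definition orbits_definable (L : language) (M : structure L) (a : ord) : Prop :=
  forall n (x : n.-tuple M), Sigma_definable a (aut_orbit x).

Definition is_SR (L : language) (M : structure L) (a : ord) : Prop :=
  orbits_definable M a /\ forall b, orbits_definable M b -> ole a b.

Definition expand_language (L : language) (k : nat) : language :=
  {| rsym := rsym L; arity := @arity L; csym := (csym L + 'I_k)%type |}.

Definition expand (L : language) (M : structure L) k (p : k.-tuple M) :
    structure (expand_language L k) :=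
  @Structure (expand_language L k) (carrier M) (@rinterp L M)
    (fun c => match c with inl c => cinterp M c | inr i => tnth p i end).

Definition is_pSR (L : language) (M : structure L) (a : ord) : Prop :=
  (exists k (p : k.-tuple M), is_SR (expand p) a) /\
  (forall k (p : k.-tuple M) b, is_SR (expand p) b -> ole a b).

Definition covers (T : Type) (R : T -> T -> Prop) (x y : T) : Prop :=
  R x y /\ ~ exists z, R x z /\ R z y.

Record tree := Tree {
  node :> Type;
  prec : node -> node -> Prop;
  tree_root : node;
  prec_irr : forall x, ~ prec x x;
  prec_trans : forall x y z, prec x y -> prec y z -> prec x z;
  prec_finite : forall x, finite_set [set y | prec y x];
  prec_linear : forall x y z,
    prec y x -> prec z x -> [\/ prec y z, y = z | prec z y];
  root_least : forall x, x = tree_root \/ prec tree_root x;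
  tree_countable : countable [set: node];
  tree_no_path : ~ exists f : nat -> node, forall n, covers prec (f n) (f n.+1) }.
Arguments prec {t} _ _.
Arguments tree_root {t}.

Definition tree_language : language :=
  {| rsym := unit; arity := fun _ => 2; csym := void |}.

Definition tree_structure (T : tree) : structure tree_language :=
  @Structure tree_language (node T)
    (fun _ (t : 2.-tuple T) => prec (tnth t ord0) (tnth t ord_max))
    (fun c : void => match c with end).

Definition has_level (T : tree) (x : T) (n : nat) : Prop :=
  [set y | prec y x] #= `I_n.

(* The right-hand side says that rk x is the supremum of the rk y + 1, y an
   immediate successor of x. *)
Definition is_rank (T : tree) (rk : T -> ord) : Prop :=
  forall x a, ole (rk x) a <-> (forall y, covers prec x y -> olt (rk y) a).

Definition has_rank (T : tree) (a : ord) : Prop :=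
  exists2 rk : T -> ord, is_rank rk & oeq (rk tree_root) a.

Section Subtree.
Variables (T : tree) (x : T).

Let up : set T := [set y | y = x \/ prec x y].
Let R (y z : up) : Prop := prec (val y) (val z).

Lemma subtree_root_in : x \in up.
Proof. by rewrite inE; left. Qed.

Lemma subtree_covers y z : covers R y z -> covers prec (val y) (val z).
Proof.
move=> [Ryz nbet]; split=> // -[w [yw wz]]; apply: nbet.
have w_up : w \in up.
  rewrite inE; right; have := valP y; rewrite inE => -[<-//|xy].
  exact: prec_trans xy yw.
by exists (exist _ w w_up).
Qed.

Fact subtree_finite (y : up) : finite_set [set z | R z y].
Proof.
rewrite (_ : [set z | R z y] = (val : up -> T) @^-1` [set z | prec z (val y)]) //.
apply: finite_preimage; last exact: prec_finite.
by move=> ? ? _ _; exact: val_inj.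
Qed.

Fact subtree_linear (y z w : up) : R z y -> R w y -> [\/ R z w, z = w | R w z].
Proof.
move=> zy wy; case: (prec_linear zy wy) => h; first by constructor 1.
  by constructor 2; exact: val_inj.
by constructor 3.
Qed.

Fact subtree_least (y : up) :
  y = exist _ x subtree_root_in \/ R (exist _ x subtree_root_in) y.
Proof.
have := valP y; rewrite inE => -[yx|xy]; last by right.
by left; exact: val_inj.
Qed.

Fact subtree_countable : countable [set: up].
Proof.
have /countable_injP[f f_inj] := tree_countable T.
apply/countable_injP; exists (f \o val) => y z _ _ /f_inj h.
by apply: val_inj; apply: h; rewrite inE.
Qed.

Fact subtree_no_path : ~ exists f : nat -> up, forall n, covers R (f n) (f n.+1).
Proof.
move=> [f f_path]; apply: (@tree_no_path T); exists (fun n => val (f n)) => n.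
exact: subtree_covers.
Qed.

Definition subtree : tree :=
  @Tree up R (exist _ x subtree_root_in)
    (fun y => @prec_irr T (val y))
    (fun y z w => @prec_trans T (val y) (val z) (val w))
    subtree_finite subtree_linear subtree_least subtree_countable
    subtree_no_path.

End Subtree.

Inductive ncard := Fin of nat | Omega.

Definition has_card (T : Type) (A : set T) (N : ncard) : Prop :=
  match N with Fin k => A #= `I_k | Omega => A #= [set: nat] end.

(* [tree_type n N T]: T is of type [n:N]; there is no type with n = 0. *)
Fixpoint tree_type (n : nat) (N : ncard) (T : tree) : Prop :=
  match n with
  | 0 => False
  | 1 => (exists2 a, has_rank T a & ole a (onat 1)) /\
         has_card [set y : T | covers prec tree_root y] N
  | n'.+1 =>
    [/\ has_rank T (onat n),
        has_card [set y : T | has_level y 1 /\ tree_type n' Omega (subtree y)] N,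
        forall k, has_card
          [set y : T | has_level y 1 /\ tree_type n' (Fin k) (subtree y)] Omega
      & forall y : T, has_level y 1 ->
          tree_type n' Omega (subtree y) \/
          exists k, tree_type n' (Fin k) (subtree y)]
  end.

(* Main.v *)
Require Import Defs.
From mathcomp Require Import all_boot all_classical zify.
From Stdlib Require List.

(** Let [A] be a tree of type [[m+1 : omega]].  The subtree above a node [x] of
    level [l <= m] has type [[m+1-l : N]] for exactly one [N], called [typ x]
    below, and nodes of level [m+1] are terminal.  Put [h = m+1-l], the height
    of [x].  The complexity of [A] is that of counting: [x] has at least [k]
    children of type [Omega] is a Sigma_(2h-1) property, so [typ x = Omega] is
    Pi_(2h), and [typ x = k] is a conjunction of a Sigma_(2h-1) and a
    Pi_(2h-1) property.

    Upper bound, with no parameters at all.  Extend a tuple by existential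
    quantifiers to one that contains the root and all predecessors of its
    entries.  The orbit of the longer tuple is given by its quantifier-free
    diagram, by the absence of further predecessors, and by the values of
    [typ] at heights [1..m]; all of this is Pi_(2m) ([Pdef_same_diagram]), the
    height [m+1] being that of the root alone.  Two such tuples with the same
    data are conjugate by a back-and-forth argument ([same_diagram_iso]).  So
    every orbit is Sigma_(2m+1).

    Lower bound, for arbitrary parameters.  Choose a level-one node [x] with
    [typ x = Omega] whose subtree contains no parameter; its height is [m].  If a
    Sigma_(2m) formula holds at [x], with witnesses [z] for its leading
    existential quantifier, then it also holds at every new level-one node
    [x'] whose type is a finite number that is large compared with the length
    of [z] ([orbit_not_Sigma]).  Such an [x'] is not in the orbit of [x].

    Both bounds come from a single extension property of finite matchings, that
    is, partial isomorphisms between finite sets closed under predecessors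
    ([step_matching_child]).  A matching may pair nodes of different types as
    long as the quantifiers still to be played cannot detect the difference:
    at height [h], Pi_a formulas do not see [typ] for [a <= 2h-2], see it only
    monotonically for [a = 2h-1], and see its exact value from [a = 2h] on
    ([pi_related]).  Formulas of complexity [a] are therefore preserved by
    matchings related at [a] ([transfer]), and when [a] exceeds all [2h] the
    matchings form a back-and-forth system that produces automorphisms
    ([typed_matching_iso]). *)

Set Implicit Arguments.
Unset Strict Implicit.
Unset Printing Implicit Defensive.

Local Open Scope classical_set_scope.
Local Open Scope card_scope.

(** * Ordinals, cardinals and lists *)

Lemma ole_trans a b c : ole a b -> ole b c -> ole a c.
Proof.
elim: a b c => A f IH [B g] [C h] /= fg gh i.
have [j fij] := fg i; have [k gjk] := gh j.
by exists k; exact: IH gjk.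
Qed.

Lemma olt_le_trans a b c : olt a b -> ole b c -> olt a c.
Proof.
case: b c => [B g] [C h] /= [j aj] gh; have [k jk] := gh j.
by exists k; exact: ole_trans jk.
Qed.

(** If [a] is not at most [b], some term [f i] of [a] is not below [b], and
    induction on [b] gives [ole b (f i)]. *)
Lemma ole_total a b : ~ ole a b -> olt b a.
Proof.
elim: b a => B g IH [A f] /= /existsNP[i nfi].
by exists i => j; apply: (IH j) => fij; apply: nfi; exists j.
Qed.

Lemma olt_onatS a n : olt a (onat n.+1) <-> ole a (onat n).
Proof. by split=> [[[]]|?] //; exists tt. Qed.

Lemma ole_onat_refl n : ole (onat n) (onat n).
Proof. by elim: n => [[]|n IH /= i]; exists tt. Qed.

Lemma olt_onat a n : olt a (onat n) -> 0 < n.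
Proof. by case: n => // -[[]]. Qed.

Lemma card_le_enum T (A : set T) k :
  `I_k #<= A <-> exists2 f : 'I_k -> T, injective f & forall i, A (f i).
Proof.
split=> [|[f f_inj fA]]; last first.
  rewrite (card_le_eql card_II) -(card_le_eql (inj_card_eq (in2W f_inj))).
  by apply: subset_card_le => _ [i _ <-].
elim/Ppointed: T => T in A *.
  case: k => [_|k].
    by exists (fun i : 'I_0 => match notF (valP i) with end) => -[].
  rewrite card_le_emptyr => /eqP I0.
  by have : `I_k.+1 0 by []; rewrite I0.
move=> /pcard_leP[f]; exists (fun i : 'I_k => f i) => [i j|i].
  by move=> /inj fij; apply/val_inj/fij; rewrite inE /= ltn_ord.
by apply: funS => /=.
Qed.

Lemma card_setU1 T (A : set T) x n :
  ~ A x -> A #= `I_n -> A `|` [set x] #= `I_n.+1.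
Proof.
move=> nAx An; apply/eq_cardSP; exists x; first by right.
suff -> : (A `|` [set x]) `\` [set x] = A by [].
apply/seteqP; split=> [y [[]]|y Ay] //; split; first by left.
by move=> /= yx; apply: nAx; rewrite -yx.
Qed.

Lemma card_bij T U (A : set T) (B : set U) (f : T -> U) :
  bijective f -> (forall x, A x <-> B (f x)) -> A #= B.
Proof.
move=> [g fK gK] AB.
rewrite -(card_eql (inj_card_eq (in2W (can_inj fK)))).
suff -> : f @` A = B by [].
apply/seteqP; split=> [_ [x /AB + <-]|y By] //.
by exists (g y); rewrite ?gK //; apply/AB; rewrite gK.
Qed.

Lemma has_card_eq T U (A : set T) (B : set U) N :
  A #= B -> has_card A N -> has_card B N.
Proof. by case: N => [k|] AB /=; rewrite (card_eql AB). Qed.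

Lemma has_card_inj T (A : set T) N N' : has_card A N -> has_card A N' -> N = N'.
Proof.
have inf k : ~ (`I_k #= [set: nat]).
  by move=> /card_esym kN; apply: infinite_nat; exists k.
case: N N' => [k|] [k'|] //=.
- by move=> /card_eql ->/card_eq_II ->.
- by move=> /card_eql -> /inf.
- by move=> /card_eql -> /card_esym/inf.
Qed.

Definition ncle (N N' : ncard) : Prop :=
  match N, N' with
  | _, Omega => True
  | Omega, Fin _ => False
  | Fin k, Fin k' => k <= k'
  end.

Lemma has_card_ge (T : Type) (E : set T) N k :
  has_card E N -> `I_k #<= E <-> ncle (Fin k) N.
Proof.
case: N => [c|] /= Ec; rewrite (card_le_eqr Ec) ?card_le_II //.
by split=> // _; exact: subset_card_le.
Qed.

Lemma ncle_inj N N' :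
  (forall k, ncle (Fin k) N <-> ncle (Fin k) N') -> N = N'.
Proof.
case: N N' => [c|] [c'|] //= H.
- congr Fin; apply/eqP; rewrite eqn_leq.
  by apply/andP; split; [apply/(H c)|apply/(H c')].
- by have := (H c.+1).2 I; rewrite ltnn.
- by have := (H c'.+1).1 I; rewrite ltnn.
Qed.

Lemma in_nth (T : Type) (x0 : T) l x :
  List.In x l <-> exists2 i, i < size l & nth x0 l i = x.
Proof.
elim: l => [|y l IH] /=; first by split=> [|[]].
split=> [[->|/IH[i il ix]]|[[|i] il ix]]; [by exists 0| |by left|].
  by exists i.+1.
by right; apply/IH; exists i.
Qed.

Lemma in_tnth (T : Type) n (x : n.-tuple T) i : List.In (tnth x i) x.
Proof.
by apply/(in_nth (tnth x i)); exists i; rewrite ?size_tuple -?tnth_nth.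
Qed.

Lemma in_list_card (T : Type) (l : seq T) :
  [set x | List.In x l] #<= `I_(size l).
Proof.
case: l => [|x0 l].
  by rewrite (_ : [set x | List.In x [::]] = set0) //; apply/seteqP; split.
apply: card_le_trans (card_image_le (nth x0 (x0 :: l)) _).
by apply: subset_card_le => x /= /(@in_nth _ x0 (x0 :: l)) [i]; exists i.
Qed.

Lemma infinite_avoids (T : Type) (E : set T) (l : seq T) :
  E #= [set: nat] -> exists2 x, E x & ~ List.In x l.
Proof.
move=> EN; apply: contrapT => nex.
have /subset_card_le El : E `<=` [set x | List.In x l].
  by move=> x Ex; apply: contrapT => xl; apply: nex; exists x.
suff : `I_(size l).+1 #<= `I_(size l) by rewrite card_le_II ltnn.
apply: card_le_trans (in_list_card l); apply: card_le_trans El.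
by rewrite (card_le_eqr EN); apply: subset_card_le.
Qed.

(** * Levels, subtrees and isomorphisms of trees *)

Section TreeLevels.
Variable T : tree.
Implicit Types x y z : T.

Definition lev x : nat := projT1 (cid (prec_finite x)).

Lemma lev_card x : [set y | prec y x] #= `I_(lev x).
Proof. by rewrite /lev; case: cid. Qed.

Lemma prec_lev x y : prec x y -> lev x < lev y.
Proof.
move=> xy; rewrite -card_le_II -(card_le_eqr (lev_card y)).
have xx : ~ [set z | prec z x] x := @prec_irr _ _.
rewrite -(card_le_eql (card_setU1 xx (lev_card x))).
by apply: subset_card_le => z [zx|/= ->] //; exact: prec_trans zx xy.
Qed.

Lemma covers_prec x y z : covers prec x y -> prec z y <-> z = x \/ prec z x.
Proof.
move=> [xy nb]; split=> [zy|[->|zx]] //; last exact: prec_trans zx xy.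
case: (prec_linear zy xy) => [|->|xz]; [by right|by left|].
by case: nb; exists z.
Qed.

Lemma covers_lev x y : covers prec x y -> lev y = (lev x).+1.
Proof.
move=> xy; apply/card_eq_II; rewrite -(card_eql (lev_card y)).
have xx : ~ [set z | prec z x] x := @prec_irr _ _.
rewrite -(card_eqr (card_setU1 xx (lev_card x))).
suff -> : [set z | prec z y] = [set z | prec z x] `|` [set x] by [].
by apply/seteqP; split=> z /=; rewrite (covers_prec z xy) => -[];
  [right|left|right|left].
Qed.

Lemma covers_inj x x' y : covers prec x y -> covers prec x' y -> x = x'.
Proof.
move=> xy x'y; have /(covers_prec _ xy)[//|] := x'y.1.
have /(covers_prec _ x'y)[//|xx' x'x] := xy.1.
by case: (prec_irr (prec_trans xx' x'x)).
Qed.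

Lemma prec_root x : ~ prec x (tree_root : T).
Proof.
case: (root_least x) => [->|rx xr]; first exact: prec_irr.
exact: prec_irr (prec_trans rx xr).
Qed.

(** A predecessor of maximal level is an immediate one. *)
Lemma covers_ex y : y <> tree_root -> exists x, covers prec x y.
Proof.
move=> yr; have ry : prec tree_root y by case: (root_least y).
pose P n := `[< exists2 x, prec x y & lev x = n >].
have exP : exists n, P n.
  by exists (lev (tree_root : T)); apply/asboolP; exists tree_root.
have ubP n : P n -> n <= lev y.
  by move=> /asboolP[x /prec_lev + <-]; exact: ltnW.
case: (ex_maxnP exP ubP) => n /asboolP[x xy <-] xmax.
exists x; split=> // -[z [xz zy]]; have := prec_lev xz; rewrite ltnNge xmax //.
by apply/asboolP; exists z.
Qed.

Lemma lev_root : lev (tree_root : T) = 0.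
Proof.
apply/card_eq_II; rewrite -(card_eql (lev_card tree_root)).
by rewrite II0 card_eq0; apply/eqP/seteqP; split=> x // /prec_root.
Qed.

Lemma lev0 x : lev x = 0 -> x = tree_root.
Proof.
by case: (root_least x) => // /prec_lev; rewrite lev_root => /[swap] ->.
Qed.

Lemma lev_coversP x y : prec x y -> lev y = (lev x).+1 -> covers prec x y.
Proof.
move=> xy yx; split=> // -[z [/prec_lev xz /prec_lev zy]].
by rewrite yx ltnS leqNgt xz in zy.
Qed.

Lemma has_level1 x : has_level x 1 <-> covers prec tree_root x.
Proof.
split=> [x1|rx].
  have := card_esym (lev_card x); rewrite (card_eqr x1) => /card_eq_II l1.
  have [y xy] : exists y, covers prec y x.
    by apply: covers_ex => xr; move: l1; rewrite xr lev_root.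
  by move: l1; rewrite (covers_lev xy) => -[/lev0 <-].
by have := lev_card x; rewrite (covers_lev rx) lev_root.
Qed.

Lemma lev_ind (P : T -> Prop) :
  P tree_root -> (forall x y, covers prec x y -> P x -> P y) -> forall x, P x.
Proof.
move=> P0 PS x; move: {2}(lev x) (erefl (lev x)) => n.
elim: n x => [|n IH] x xn; first by rewrite (lev0 xn).
have [|y yx] := @covers_ex x; first by move=> xr; move: xn; rewrite xr lev_root.
by apply: (PS _ _ yx); apply: IH; move: xn; rewrite (covers_lev yx) => -[].
Qed.

(** Matchings relate sets closed under predecessors, so tuples have to be
    completed to such sets. *)
Lemma down_closure (l : seq T) : exists l' : seq T,
  (forall x, List.In x l -> List.In x l') /\
  forall y, List.In y l' -> forall z, prec z y -> List.In z l'.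
Proof.
have one : forall x : T, exists l' : seq T,
    List.In x l' /\ forall y, List.In y l' -> forall z, prec z y -> List.In z l'.
  apply: lev_ind => [|x y xy [l' [xl' l'P]]].
    by exists [:: tree_root]; split=> [|y [<-|[]] z /prec_root] //; left.
  exists (y :: l'); split=> [|z [<-|zl'] t]; first by left.
    by move=> /(covers_prec _ xy)[->|/(l'P _ xl') tl']; right.
  by move=> /(l'P _ zl'); right.
elim: l => [|x l [l1 [ll1 l1P]]]; first by exists [::].
have [l2 [xl2 l2P]] := one x; exists (l2 ++ l1); split=> [y|y].
  by rewrite List.in_app_iff => -[<-|/ll1]; [left|right].
move=> yl z zy; move: yl; rewrite !List.in_app_iff => -[yl|yl].
  by left; exact: l2P zy.
by right; exact: l1P zy.
Qed.

End TreeLevels.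

(** Weaker than being an isomorphism, in order to cover as well the inclusion
    of a subtree into the tree. *)
Definition upward_iso (T U : tree) (f : T -> U) (x : T) : Prop :=
  [/\ injective f, forall y z, prec (f y) (f z) <-> prec y z
    & forall z, prec (f x) z -> exists y, f y = z].

Definition tree_iso (T U : tree) (f : T -> U) : Prop :=
  bijective f /\ forall y z, prec (f y) (f z) <-> prec y z.

Lemma tree_iso_inv (T U : tree) (f : T -> U) :
  tree_iso f -> exists g : U -> T, tree_iso g.
Proof.
move=> [[g fK gK] fP]; exists g; split=> [|y z]; first by exists f.
by rewrite -fP !gK.
Qed.

Lemma tree_iso_upward (T U : tree) (f : T -> U) x : tree_iso f -> upward_iso f x.
Proof.
by move=> [[g fK gK] fP]; split=> // [|z _]; [exact: can_inj fK|exists (g z)].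
Qed.

Lemma subtree_iso (T U : tree) (f : T -> U) x : upward_iso f x ->
  exists h : subtree x -> subtree (f x), tree_iso h.
Proof.
move=> [f_inj fP f_up].
have hP (y : subtree x) : f (val y) \in [set z | z = f x \/ prec (f x) z].
  by have := valP y; rewrite !inE => -[->|xy]; [left|right; apply/fP].
pose h (y : subtree x) : subtree (f x) := exist _ (f (val y)) (hP y).
exists h; split; last by move=> y z; exact: fP.
rewrite -setTT_bijective; split=> // [y z _ _ /(congr1 val)/f_inj/val_inj //|z _ /=].
have [y yz xy] : exists2 y, f y = val z & y \in [set z | z = x \/ prec x z].
  have := valP z; rewrite inE => -[zx|/[dup] xz /f_up[y yz]].
    by exists x; rewrite ?zx // inE; left.
  by exists y => //; rewrite inE; right; apply/fP; rewrite yz.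
by exists (exist _ y xy) => //; apply: val_inj.
Qed.

Lemma iso_lev (T U : tree) (f : T -> U) x : tree_iso f -> lev (f x) = lev x.
Proof.
move=> [f_bij fP]; apply/card_eq_II.
rewrite -(card_eql (lev_card (f x))) -(card_eqr (lev_card x)) card_eq_sym.
by apply: (card_bij f_bij) => y /=; rewrite fP.
Qed.

Lemma iso_covers (T U : tree) (f : T -> U) x y :
  tree_iso f -> covers prec x y <-> covers prec (f x) (f y).
Proof.
move=> [[g fK gK] fP]; split=> -[xy nb]; split; try exact/fP.
  by move=> [z [xz zy]]; apply: nb; exists (g z); rewrite -!fP gK.
by move=> [z [xz zy]]; apply: nb; exists (f z); rewrite !fP.
Qed.

Lemma iso_root (T U : tree) (f : T -> U) : tree_iso f -> f tree_root = tree_root.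
Proof.
move=> [[g fK gK] fP]; case: (root_least (f tree_root)) => // h.
by case: (@prec_root _ (g tree_root)); apply/fP; rewrite gK.
Qed.

Lemma iso_has_rank (T U : tree) (f : T -> U) a :
  tree_iso f -> has_rank T a -> has_rank U a.
Proof.
move=> ff [rk rkP rka]; have [[g fK gK] fP] := ff.
exists (rk \o g); last by rewrite /= -(iso_root ff) fK.
move=> x b; rewrite /= rkP; split=> H y xy.
  by apply: H; rewrite (iso_covers _ _ ff) !gK.
by rewrite -[y]fK; apply: H; rewrite -[x]gK -(iso_covers _ _ ff).
Qed.

(** For rewriting: computation would unfold the inner [tree_type] too. *)
Lemma tree_typeSS n N (T : tree) : tree_type n.+2 N T =
  [/\ has_rank T (onat n.+2),
      has_card [set y : T | has_level y 1 /\ tree_type n.+1 Omega (subtree y)] N,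
      forall k, has_card
        [set y : T | has_level y 1 /\ tree_type n.+1 (Fin k) (subtree y)] Omega
    & forall y : T, has_level y 1 ->
        tree_type n.+1 Omega (subtree y) \/
        exists k, tree_type n.+1 (Fin k) (subtree y)].
Proof. by []. Qed.

Lemma iso_tree_type (T U : tree) (f : T -> U) n N :
  tree_iso f -> tree_type n N T -> tree_type n N U.
Proof.
elim: n N T U f => // -[|n] IH N T U f ff.
  move=> [[a Ta a1] TN]; split.
    by exists a => //; exact: (iso_has_rank ff Ta).
  apply: has_card_eq TN; apply: (card_bij ff.1) => x /=.
  by rewrite -(iso_root ff) (iso_covers _ _ ff).
have lev1 x : has_level x 1 <-> has_level (f x) 1.
  by rewrite !has_level1 (iso_covers _ _ ff) (iso_root ff).
have sub N' x :
    tree_type n.+1 N' (subtree x) <-> tree_type n.+1 N' (subtree (f x)).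
  have [h hi] := subtree_iso (tree_iso_upward x ff).
  split=> [|xN]; first exact: IH hi.
  by have [g gi] := tree_iso_inv hi; apply: IH gi xN.
rewrite !tree_typeSS; case=> Tr TN Tk Tall; split.
- exact: (iso_has_rank ff Tr).
- apply: has_card_eq TN; apply: (card_bij ff.1) => x.
  by split=> -[/lev1 x1 xN]; split=> //; exact/sub.
- move=> k; apply: has_card_eq (Tk k); apply: (card_bij ff.1) => x.
  by split=> -[/lev1 x1 xN]; split=> //; exact/sub.
- move=> y; have [[g fK gK] _] := ff; rewrite -[y]gK -lev1 => /Tall.
  by case=> [|[k]] /sub; [left|right; exists k].
Qed.

(** [N] is the cardinal of a set of nodes that depends on the tree and on [n]
    only. *)
Lemma tree_type_inj n N N' (T : tree) :
  tree_type n N T -> tree_type n N' T -> N = N'.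
Proof.
case: n => [|[|n]] //; first by move=> [_ +] [_]; exact: has_card_inj.
by move=> [_ + _ _] [_ + _ _]; exact: has_card_inj.
Qed.

(** A subtree of a subtree and the same subtree of the whole tree have
    different carriers, and are merely isomorphic. *)
Lemma tree_type_subtree n N (T : tree) (x : T) (y : subtree x) :
  tree_type n N (subtree y) <-> tree_type n N (subtree (val y)).
Proof.
have up : @upward_iso (subtree x) T (fun z => val z) y.
  split=> [|//|z yz]; first exact: val_inj.
  suff xz : z \in [set z | z = x \/ prec x z] by exists (exist _ z xz).
  rewrite inE; right; have := valP y; rewrite inE => -[<-//|xy].
  exact: prec_trans xy yz.
have [h hi] := subtree_iso up; split=> [|yN]; first exact: iso_tree_type hi.
by have [g gi] := tree_iso_inv hi; apply: iso_tree_type gi yN.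
Qed.

(** * The type of a node *)

Lemma subtree_val_covers (T : tree) (x : T) (y z : subtree x) :
  covers prec y z <-> covers prec (val y) (val z).
Proof.
split; first exact: subtree_covers.
by move=> [yz nb]; split=> // -[u [yu uz]]; apply: nb; exists (val u).
Qed.

Lemma subtree_children (T : tree) (x : T) (P : T -> Prop) :
  [set y : subtree x | has_level y 1 /\ P (val y)] #=
  [set y : T | covers prec x y /\ P y].
Proof.
rewrite card_eq_sym.
suff -> : [set y : T | covers prec x y /\ P y] =
  (fun y : subtree x => val y) @` [set y : subtree x | has_level y 1 /\ P (val y)].
  by apply: inj_card_eq; exact: in2W val_inj.
apply/seteqP; split=> y /=.
  move=> [xy Py]; have up : y \in [set z | z = x \/ prec x z].
    by rewrite inE; right; exact: xy.1.
  exists (exist _ y up) => //; split=> //.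
  by apply/has_level1/subtree_val_covers.
by move=> [z [/has_level1/subtree_val_covers xz Pz] <-].
Qed.

Lemma subtree_root_iso (T : tree) :
  tree_iso (fun y : subtree (tree_root : T) => val y).
Proof.
split=> //; rewrite -setTT_bijective.
split=> // y _; have up : y \in [set z | z = tree_root \/ prec tree_root z].
  by rewrite inE; exact: root_least.
by exists (exist _ y up).
Qed.

(** What the rest of the proof uses of a tree of type [[m+1 : omega]].
    Nodes of level [m+1] have no type and are given the value [Omega]: with this
    convention [typ x] counts the children of value [Omega] at level [m] too,
    where it has to count all children. *)
Record typing (m : nat) (T : tree) (typ : T -> ncard) : Prop := Typing {
  typ_lev : forall x : T, lev x <= m.+1;
  typ_root : typ tree_root = Omega;
  typ_leaf : forall x, lev x = m.+1 -> typ x = Omega;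
  typ_omega : forall x, lev x <= m ->
    has_card [set y | covers prec x y /\ typ y = Omega] (typ x);
  typ_fin : forall x, lev x < m -> forall k,
    has_card [set y | covers prec x y /\ typ y = Fin k] Omega;
  typ_iso : forall (f : T -> T) x, tree_iso f -> typ (f x) = typ x }.

Lemma tree_type_subtree_ex m N (T : tree) (x : T) :
  tree_type m.+1 N T -> lev x <= m ->
  exists N', tree_type (m.+1 - lev x) N' (subtree x).
Proof.
move=> TN; move: x; apply: lev_ind => [|x y xy IH] lxm.
  have [g gi] := tree_iso_inv (@subtree_root_iso T).
  by exists N; rewrite lev_root; exact: iso_tree_type gi TN.
move: IH lxm; rewrite (covers_lev xy) => IH lxm; have [N' ] := IH (ltnW lxm).
have -> : m.+1 - lev x = (m - (lev x).+1).+2 by lia.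
have -> : m.+1 - (lev x).+1 = (m - (lev x).+1).+1 by lia.
rewrite tree_typeSS => -[_ _ _ Tall].
have up : y \in [set z | z = x \/ prec x z] by rewrite inE; right; exact: xy.1.
have [|yO|[k yk]] := Tall (exist _ y up).
- exact/has_level1/subtree_val_covers.
- by exists Omega; apply/(tree_type_subtree _ _ (exist _ y up)).
- by exists (Fin k); apply/(tree_type_subtree _ _ (exist _ y up)).
Qed.

Lemma tree_type1_leaf N (T : tree) (x : T) y z :
  tree_type 1 N (subtree x) -> covers prec x y -> ~ covers prec y z.
Proof.
move=> [[a [rk rkP [rka _]] a1] _] xy yz.
have upy : y \in [set z | z = x \/ prec x z] by rewrite inE; right; exact: xy.1.
have upz : z \in [set z | z = x \/ prec x z].
  by rewrite inE; right; exact: prec_trans xy.1 yz.1.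
have /rkP root1 := ole_trans rka a1.
have /root1/olt_onatS/rkP y0 : covers prec tree_root (exist _ y upy : subtree x).
  exact/subtree_val_covers.
have /y0/olt_onat // : covers prec (exist _ y upy : subtree x) (exist _ z upz).
exact/subtree_val_covers.
Qed.

Lemma typing_ex m (T : tree) :
  tree_type m.+1 Omega T -> exists typ, @typing m T typ.
Proof.
move=> TO.
have [typ typP] : {typ : T -> ncard & forall x,
    (lev x <= m -> tree_type (m.+1 - lev x) (typ x) (subtree x)) /\
    (m < lev x -> typ x = Omega)}.
  apply: (@boolp.choice _ _ (fun x N =>
    (lev x <= m -> tree_type (m.+1 - lev x) N (subtree x)) /\
    (m < lev x -> N = Omega))) => x.
  case: (leqP (lev x) m) => [/(tree_type_subtree_ex TO)[N xN]|].
    by exists N.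
  by exists Omega.
have typE n N x : lev x <= m -> m.+1 - lev x = n ->
    tree_type n N (subtree x) <-> typ x = N.
  move=> /(typP x).1 + <- => xt; split=> [|<- //]; exact: tree_type_inj.
have levT : forall x : T, lev x <= m.+1.
  apply: lev_ind => [|y z yz IH]; first by rewrite lev_root.
  rewrite (covers_lev yz) ltnS leqNgt; apply/negP => my.
  have {IH my} ym : lev y = m.+1 by apply/eqP; rewrite eqn_leq IH.
  have [yr|x xy] := @covers_ex _ y; first by move: ym; rewrite yr lev_root.
  have xm : lev x = m by move: ym; rewrite (covers_lev xy) => -[].
  have := (typP x).1; rewrite xm leqnn subSnn => /(_ isT) x1.
  exact: tree_type1_leaf x1 xy yz.
have subE x : lev x < m -> m.+1 - lev x = (m - (lev x).+1).+2 by lia.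
have childE x N : lev x < m ->
    [set y : subtree x | has_level y 1 /\
      tree_type (m - (lev x).+1).+1 N (subtree y)] #=
    [set y | covers prec x y /\ typ y = N].
  move=> xm; rewrite -(card_eqr (subtree_children x (fun y => typ y = N))).
  suff -> : [set y : subtree x | has_level y 1 /\
        tree_type (m - (lev x).+1).+1 N (subtree y)] =
      [set y : subtree x | has_level y 1 /\ typ (val y) = N] by [].
  apply/seteqP; split=> y [y1 yN]; split=> //; move: yN;
    have ly := covers_lev (subtree_covers ((has_level1 _).1 y1)).
    by move/tree_type_subtree/typE; apply; rewrite ly /=; lia.
  by move=> yN; apply/tree_type_subtree/typE => //; rewrite ly /=; lia.
exists typ; split=> //.
- have [N rN] : exists N, typ tree_root = N by exists (typ tree_root).
  apply/(typE m.+1); rewrite ?lev_root //.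
  have [g gi] := tree_iso_inv (@subtree_root_iso T).
  exact: iso_tree_type gi TO.
- by move=> x xm; apply: (typP x).2; rewrite xm.
- move=> x; rewrite leq_eqVlt => /orP[/eqP xm|xm].
    have := (typP x).1; rewrite xm leqnn subSnn => /(_ isT)[_].
    apply: has_card_eq.
    have -> : [set y : subtree x | covers prec tree_root y] =
        [set y : subtree x | has_level y 1 /\ (fun y => typ y = Omega) (val y)].
      apply/seteqP; split=> y /=; rewrite has_level1; last by case.
      move=> xy; split=> //; apply: (typP _).2.
      by move/subtree_val_covers/covers_lev: xy => /= ->; rewrite xm.
    exact: subtree_children.
  have := (typP x).1 (ltnW xm); rewrite subE // tree_typeSS => -[_ + _ _].
  by apply: has_card_eq; exact: childE.
- move=> x xm k; have := (typP x).1 (ltnW xm).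
  rewrite subE // tree_typeSS => -[_ _ /(_ k) + _].
  by apply: has_card_eq; exact: childE.
- move=> f x ff; have fx := iso_lev x ff; case: (leqP (lev x) m) => xm.
    have [h hi] := subtree_iso (tree_iso_upward x ff).
    apply/(typE (m.+1 - lev x)); rewrite ?fx //.
    by apply: iso_tree_type hi _; exact: (typP x).1.
  by rewrite !(typP _).2 ?fx.
Qed.

(** * Finite matchings and their extension *)

Definition swap_pairs (T : Type) (s : seq (T * T)) := [seq (p.2, p.1) | p <- s].

Lemma in_swap (T : Type) (s : seq (T * T)) u v :
  List.In (u, v) (swap_pairs s) <-> List.In (v, u) s.
Proof.
rewrite /swap_pairs List.in_map_iff; split=> [[[a b] [[<- <-]]] //|vu].
by exists (v, u).
Qed.

Section Matching.
Variable T : tree.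
Implicit Types (u v w x : T) (s : seq (T * T)) (R : T -> T -> Prop).

(** A partial isomorphism between two sets closed under predecessors; this
    closure and the preservation of the order both follow from the clause on
    parents ([matching_prec]).  It is stated for relations, and not only for
    finite lists of pairs, so that it also applies to the union of a chain of
    finite matchings. *)
Definition matching (R : T -> T -> Prop) : Prop :=
  [/\ R tree_root tree_root,
      forall u v u' v', R u v -> R u' v' -> u = u' <-> v = v'
    & forall u v, R u v -> (u = tree_root /\ v = tree_root) \/
        exists w w', [/\ R w w', covers prec w u & covers prec w' v]].

Lemma matching_swap R : matching R -> matching (fun u v => R v u).
Proof.
move=> [Rr Rf Rp]; split=> // [u v u' v' uv u'v'|u v uv].
  by split=> /(Rf _ _ _ _ uv u'v').
have [[-> ->]|[w [w' [ww' wu w'v]]]] := Rp _ _ uv; first by left.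
by right; exists w', w.
Qed.

Lemma matching_swap_pairs s : matching (fun u v => List.In (u, v) s) ->
  matching (fun u v => List.In (u, v) (swap_pairs s)).
Proof.
suff -> : (fun u v => List.In (u, v) (swap_pairs s)) =
    (fun u v => List.In (v, u) s).
  exact: matching_swap.
by apply/funext => u; apply/funext => v; apply/propext; exact: in_swap.
Qed.

Lemma covers_root (x : T) : ~ covers prec x tree_root.
Proof. by move=> [/prec_root]. Qed.

Lemma matching_parent R u v w : matching R -> R u v -> covers prec w u ->
  exists2 w', R w w' & covers prec w' v.
Proof.
move=> [Rr Rf Rp] uv wu.
have [[ur _]|[w1 [w' [ww' w1u w'v]]]] := Rp _ _ uv.
  by case: (@covers_root w); rewrite -ur.
by exists w'; rewrite // (covers_inj wu w1u).
Qed.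

Lemma matching_root R v : matching R -> R tree_root v -> v = tree_root.
Proof. by move=> [Rr Rf _] rv; apply/esym/(Rf _ _ _ _ Rr rv). Qed.

Lemma matching_lev R u v : matching R -> R u v -> lev u = lev v.
Proof.
move=> Rm; move: u v.
apply: lev_ind => [v /(matching_root Rm) -> //|w u wu IH v uv].
have [w' ww' w'v] := matching_parent Rm uv wu.
by rewrite (covers_lev wu) (covers_lev w'v) (IH _ ww').
Qed.

Lemma matching_prec R u v u' v' : matching R -> R u v -> R u' v' ->
  prec u u' <-> prec v v'.
Proof.
move=> Rm uv; have [_ Rf _] := Rm.
move: u' v'; apply: lev_ind => [v' /(matching_root Rm) ->|w u' wu' IH v' u'v'].
  by split=> /prec_root.
have [w' ww' w'v'] := matching_parent Rm u'v' wu'.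
rewrite (covers_prec _ wu') (covers_prec _ w'v').
by split=> -[/(Rf _ _ _ _ uv ww')|/(IH _ ww')]; [left|right|left|right].
Qed.

Lemma matching_cons (s : seq (T * T)) w w' u v :
  matching (fun a b => List.In (a, b) s) ->
  List.In (w, w') s -> covers prec w u -> covers prec w' v ->
  (forall b, ~ List.In (u, b) s) -> (forall a, ~ List.In (a, v) s) ->
  matching (fun a b => List.In (a, b) ((u, v) :: s)).
Proof.
move=> [Rr Rf Rp] ww' wu w'v nu nv.
split=> [|a b a' b' /=|a b /=]; first by right.
- move=> [[<- <-]|ab] [[<- <-]|a'b'] //; last exact: Rf.
    by split=> e; [case: (nu b')|case: (nv a')]; rewrite e.
  by split=> e; [case: (nu b)|case: (nv a)]; rewrite -e.
- move=> [[<- <-]|/Rp[|[c [c' [cc' ca c'b]]]]]; [|by left|]; right.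
    by exists w, w'; split=> //; right.
  by exists c, c'; split=> //; right.
Qed.

Lemma identity_matching (l : seq T) : List.In tree_root l ->
  (forall y, List.In y l -> forall z, prec z y -> List.In z l) ->
  matching (fun u v => List.In (u, v) [seq (u, u) | u <- l]).
Proof.
have idP (u v : T) : List.In (u, v) [seq (u, u) | u <- l] <-> u = v /\ List.In u l.
  rewrite List.in_map_iff; split=> [[a [[<- <-]]] //|[<- ul]].
  by exists u.
move=> rl lP; split; first exact/idP.
- by move=> u v u' v' /idP[<- _] /idP[<- _].
- move=> u v /idP[<- ul]; have [->|ur] := pselect (u = tree_root); first by left.
  have [w wu] := covers_ex ur; right; exists w, w; split=> //.
  by apply/idP; split=> //; exact: lP ul _ wu.1.
Qed.

Section Typed.
Variables (m : nat) (typ : T -> ncard).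
Hypothesis typT : typing m typ.

Definition height (x : T) : nat := m.+1 - lev x.

(** How far [typ u] and [typ v] may differ for Pi_a formulas to pass from [u]
    to [v].  Having at least [k] children of type [Omega] is Sigma_(2h-1) at
    height [h]: no constraint if [a <= 2h-2], equality if [a >= 2h], and in
    between Pi_a formulas pass to the nodes of smaller type. *)
Definition pi_related a u v : Prop :=
  [\/ typ u = typ v, a + 2 <= 2 * height u
    | a + 1 <= 2 * height u /\ ncle (typ v) (typ u)].

(** The relation maintained while nodes are added on the side of [u] and
    answered on the side of [v], one at a time.  Each alternative implies
    [pi_related b u v], the aim, and the first three are what
    [pi_related b.+1 v u] gives at the start.  In the last one an infinite type
    is imitated by a finite one; [B] bounds the number of pairs that the
    matching will ever have, so that the finite supply of children of type
    [Omega] cannot run out. *)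
Definition step_related b B u v : Prop :=
  [\/ typ u = typ v, b + 3 <= 2 * height u,
      b + 2 <= 2 * height u /\ ncle (typ u) (typ v)
    | [/\ b + 1 <= 2 * height u, typ u = Omega & ncle (Fin B) (typ v)]].

Lemma step_pi_related b B u v : step_related b B u v -> pi_related b u v.
Proof.
move=> [uv|h|[h _]|[h uO _]];
  [by constructor 1|constructor 2..|constructor 3]; try lia.
by split=> //; rewrite uO; case: (typ v).
Qed.

Lemma pi_step_related b B u v :
  lev u = lev v -> pi_related b.+1 u v -> step_related b B v u.
Proof.
move=> uv; rewrite /pi_related /step_related /height uv => -[->|h|[h le]].
- by constructor 1.
- by constructor 2; lia.
- by constructor 3; split=> //; lia.
Qed.

Definition step_matching b B (s : seq (T * T)) : Prop :=
  matching (fun u v => List.In (u, v) s) /\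
  forall u v, List.In (u, v) s -> step_related b B u v.

Lemma lev_child_le w u : covers prec w u -> lev w <= m.
Proof. by move=> wu; have := typ_lev typT u; rewrite (covers_lev wu). Qed.

(** The case in which the type of the new node must be matched exactly.  By
    the bound on [height w] all pairs of children of [w] and [w'] in [s] have
    equal types.  If every child of [w'] of type [Omega] were already in [s],
    then their partners together with [u] would show that [w] has more such
    children than [w']; but [typ w] is at most [typ w'], or [typ w'] is at
    least [B] and hence larger than [s]. *)
Lemma match_omega_child b B s w w' u : step_matching b B s -> size s < B ->
  List.In (w, w') s -> covers prec w u -> (forall v, ~ List.In (u, v) s) ->
  typ u = Omega -> 2 * height w <= b + 2 ->
  exists v,
    [/\ covers prec w' v, forall u', ~ List.In (u', v) s & typ v = Omega].
Proof.
move=> [sm sok] sB ww' wu nu uO hb; have [_ sf sp] := sm.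
have lww' := matching_lev sm ww'.
pose E' := [set v | covers prec w' v /\ typ v = Omega].
have E'card : has_card E' (typ w').
  by apply: (typ_omega typT); rewrite -lww'; exact: lev_child_le wu.
apply: contrapT => nex.
have E's v : E' v -> exists u', List.In (u', v) s.
  by move=> [w'v vO]; apply: contrapT => /forallNP nv; apply: nex; exists v.
have E'sub : E' `<=` [set v | List.In v (unzip2 s)].
  by move=> v /E's[u' u'v]; apply/List.in_map_iff; exists (u', v).
case w'c : (typ w') E'card => [c|] /= E'card; last first.
  have [v [w'v vO] nv] := infinite_avoids (unzip2 s) E'card.
  by apply: nv; exact: E'sub.
have cs : c <= size s.
  rewrite -card_le_II -(card_le_eql E'card).
  apply: card_le_trans (subset_card_le E'sub) _.
  by apply: card_le_trans (in_list_card _) _; rewrite size_map.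
have wle : ncle (typ w) (Fin c).
  have := sok _ _ ww'; rewrite /step_related w'c => -[-> /=|h|[_ //]|[_ _ /= Bc]];
    by [|lia].
case wd : (typ w) wle => [d|] //= dc.
have Ecard : [set v | covers prec w v /\ typ v = Omega] #= `I_d.
  by have := typ_omega typT (lev_child_le wu); rewrite wd.
have [g gP] : {g : T -> T & forall v, E' v -> List.In (g v, v) s}.
  apply: (@boolp.choice _ _ (fun v u' => E' v -> List.In (u', v) s)) => v.
  have [/E's[u' u'v]|nE'] := pselect (E' v); first by exists u'.
  by exists v.
have gcard : g @` E' #= `I_c.
  rewrite -(card_eqr E'card); apply: inj_card_eq => v v'.
  rewrite !inE => /gP gv /gP gv' gvv'; exact/(sf _ _ _ _ gv gv').
have nug : ~ (g @` E') u by move=> [v /gP gv gu]; apply: (nu v); rewrite -gu.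
suff : `I_c.+1 #<= `I_d by rewrite card_le_II ltnNge dc.
(* The partners [g v] and the new node [u] are children of [w] of type
   [Omega]. *)
rewrite -(card_le_eqr Ecard) -(card_le_eql (card_setU1 nug gcard)).
apply: subset_card_le => _ [[v E'v <-]|/= -> //]; split.
  have [[_ vr]|[w1 [w1' [w1w1' w1g w1'v]]]] := sp _ _ (gP _ E'v).
    by case: (@covers_root w'); rewrite -vr; case: E'v.
  have w1'w' := covers_inj w1'v E'v.1; rewrite w1'w' in w1w1'.
  by have /(sf _ _ _ _ w1w1' ww') <- : w' = w' by [].
have [-> //||[+ _]|[+ _ _]] := sok _ _ (gP _ E'v); first by case: E'v.
all: rewrite /height (matching_lev sm (gP _ E'v)) (covers_lev E'v.1) -lww'.
all: by move: hb; rewrite /height; lia.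
Qed.

(** The extension property.  Children of finite type have infinitely many
    copies.  A child of type [Omega] is imitated by one of type [B] if its
    height allows it, and is matched exactly otherwise. *)
Lemma step_matching_child b B s w w' u : step_matching b B s -> size s < B ->
  List.In (w, w') s -> covers prec w u -> (forall v, ~ List.In (u, v) s) ->
  exists v, step_matching b B ((u, v) :: s).
Proof.
move=> sm sB ww' wu nu.
suff [v [w'v nv uv]] : exists v,
    [/\ covers prec w' v, forall u', ~ List.In (u', v) s & step_related b B u v].
  exists v; split; first exact: matching_cons sm.1 ww' wu w'v nu nv.
  by move=> a c /= [[<- <-] //|]; exact: sm.2.
have lww' := matching_lev sm.1 ww'; have lwu := covers_lev wu.
have lu := typ_lev typT u.
have pick_fin k : lev w < m -> exists v,
    [/\ covers prec w' v, forall u', ~ List.In (u', v) s & typ v = Fin k].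
  rewrite lww' => lw; have Ek := typ_fin typT lw k.
  have [v [w'v vk] nv] := infinite_avoids (unzip2 s) Ek.
  exists v; split=> // u' u'v; apply: nv.
  by apply/List.in_map_iff; exists (u', v).
case uk : (typ u) => [k|].
  have [|v [w'v nv vk]] := pick_fin k.
    rewrite ltn_neqAle (lev_child_le wu) andbT; apply/eqP => lw.
    by move: uk; rewrite (typ_leaf typT) // lwu lw.
  by exists v; split=> //; constructor 1; rewrite uk.
have [hb|hb] := leqP (2 * height w) (b + 2).
  have [v [w'v nv vO]] := match_omega_child sm sB ww' wu nu uk hb.
  by exists v; split=> //; constructor 1; rewrite uk.
have [|v [w'v nv vk]] := pick_fin B; first by move: hb; rewrite /height; lia.
exists v; split=> //; constructor 4; rewrite vk /=; split=> //.
by move: hb; rewrite /height lwu; lia.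
Qed.

Lemma step_matching_add b B u s :
  step_matching b B s -> size s + (lev u).+1 <= B ->
  exists s', [/\ step_matching b B s', forall p, List.In p s -> List.In p s',
    size s' <= size s + (lev u).+1 & exists v, List.In (u, v) s'].
Proof.
move=> sm; move: u; apply: lev_ind => [|w u wu IH] sB.
  by exists s; split=> //; [lia|exists tree_root; case: sm => -[]].
rewrite (covers_lev wu) in sB *.
have [|s1 [sm1 ss1 size1 [w' ww']]] := IH; first by lia.
have [[v uv]|/forallNP nu] := pselect (exists v, List.In (u, v) s1).
  by exists s1; split=> //; [lia|exists v].
have [|v smv] := step_matching_child sm1 _ ww' wu nu; first by lia.
exists ((u, v) :: s1); split=> //; last by exists v; left.
  by move=> p ps; right; exact: ss1.
by rewrite /=; lia.
Qed.

(** Adding a node may require adding its predecessors, at most [m+2] nodes in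
    all with the node itself. *)
Lemma step_matching_adds b B l s :
  step_matching b B s -> size s + m.+2 * size l <= B ->
  exists s', [/\ step_matching b B s', forall p, List.In p s -> List.In p s'
    & forall u, List.In u l -> exists v, List.In (u, v) s'].
Proof.
elim: l s => [|u l IH] s sm; first by exists s.
move=> sB; have lu := typ_lev typT u; rewrite /= mulnS in sB.
have [|s1 [sm1 ss1 size1 [v uv]]] := step_matching_add (u := u) sm; first by lia.
have [|s' [sm' s1s' s'P]] := IH _ sm1; first by lia.
exists s'; split=> // [p /ss1/s1s' //|a /= [<-|/s'P //]].
by exists v; exact: s1s'.
Qed.

Definition typed_matching (s : seq (T * T)) : Prop :=
  matching (fun u v => List.In (u, v) s) /\
  forall u v, List.In (u, v) s -> typ u = typ v.

Lemma typed_matching_swap s : typed_matching s -> typed_matching (swap_pairs s).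
Proof.
by move=> [sm st]; split=> [|u v /in_swap /st //]; exact: matching_swap_pairs.
Qed.

(** At [b = 2m+2] every alternative of [step_related] except equality of types
    is excluded, since heights are at most [m+1]. *)
Lemma typed_matching_add s u : typed_matching s ->
  exists s', [/\ typed_matching s', forall p, List.In p s -> List.In p s'
    & exists v, List.In (u, v) s'].
Proof.
move=> [sm st].
have [||s' [[sm' sok'] ss' _ su]] :=
  @step_matching_add (2 * m + 2) (size s + (lev u).+1) u s; last 1 first.
- exists s'; split=> //; split=> // a c /sok'[-> //||[+ _]|[+ _ _]];
    by rewrite /height; lia.
- by split=> // a c /st ac; constructor 1.
- by [].
Qed.

(** Back and forth: along an injective numbering [e] of the nodes, step [n]
    puts the node of number [n], if there is one, into both sides. *)
Lemma typed_matching_iso s : typed_matching s ->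
  exists2 f : T -> T, tree_iso f & forall u v, List.In (u, v) s -> f u = v.
Proof.
move=> s_ok; have /countable_injP[e e_inj] := tree_countable T.
pose step (p : seq (T * T) * nat) (s' : seq (T * T)) := typed_matching p.1 ->
  [/\ typed_matching s', forall q, List.In q p.1 -> List.In q s'
    & forall u, e u = p.2 ->
      (exists v, List.In (u, v) s') /\ exists v, List.In (v, u) s'].
have [F FP] : {F & forall p, step p (F p)}.
  apply: boolp.choice => -[s1 n]; rewrite /step /=.
  have [s1ok|] := pselect (typed_matching s1); last by exists s1.
  have [[u eu]|nu] := pselect (exists u, e u = n); last first.
    by exists s1 => _; split=> // u eu; case: nu; exists u.
  have [s2 [/typed_matching_swap s2ok s12 [v uv]]] := typed_matching_add u s1ok.
  have [s3 [/typed_matching_swap s3ok s23 [v' uv']]] := typed_matching_add u s2ok.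
  have s23' q : List.In q s2 -> List.In q (swap_pairs s3).
    by case: q => a c ac; apply/in_swap/s23/in_swap.
  exists (swap_pairs s3) => _; split=> // [q /s12/s23' //|a].
  rewrite -eu => /e_inj ->; rewrite ?inE //.
  by split; [exists v; exact: s23'|exists v'; exact/in_swap].
pose S := fix S n := if n is n'.+1 then F (S n', n') else s.
have Sok n : typed_matching (S n).
  by elim: n => //= n IH; have [] := FP (S n, n) IH.
have Smono n k q : n <= k -> List.In q (S n) -> List.In q (S k).
  elim: k => [|k IH]; first by rewrite leqn0 => /eqP ->.
  rewrite leq_eqVlt => /orP[/eqP -> //|nk /(IH nk)].
  by have [_ + _] := FP (S k, k) (Sok k); apply.
pose R u v := exists n, List.In (u, v) (S n).
have Rm : matching R.
  split; first by exists 0; case: s_ok => -[].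
  - move=> u v u' v' [n uv] [n' u'v'].
    have [[_ f _] _] := Sok (maxn n n'); apply: f.
      exact: Smono (leq_maxl _ _) uv.
    exact: Smono (leq_maxr _ _) u'v'.
  - move=> u v [n uv]; have [[_ _ p] _] := Sok n.
    have [|[w [w' [ww' wu w'v]]]] := p _ _ uv; first by left.
    by right; exists w, w'; split=> //; exists n.
have [_ Rf _] := Rm.
have Rtot u : (exists v, R u v) /\ exists v, R v u.
  have [_ _ /(_ u erefl)[[v uv] [v' v'u]]] := FP (S (e u), e u) (Sok (e u)).
  by split; [exists v|exists v']; exists (e u).+1.
have [f fR] := boolp.choice (fun u => (Rtot u).1).
have [g gR] := boolp.choice (fun u => (Rtot u).2).
exists f; last first.
  move=> u v uv; have uvR : R u v by exists 0.
  exact/(Rf _ _ _ _ (fR u) uvR).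
split; last by move=> u v; rewrite -(matching_prec Rm (fR u) (fR v)).
exists g => u; first exact/(Rf _ _ _ _ (gR _) (fR u)).
exact/(Rf _ _ _ _ (fR _) (gR u)).
Qed.

End Typed.
End Matching.

(** * Formulas preserved by matchings, and the lower bound *)

Lemma tnth_cat_lshift (U : Type) n j (x : n.-tuple U) (y : j.-tuple U) i :
  tnth [tuple of x ++ y] (lshift j i) = tnth x i.
Proof. exact: tnth_lshift. Qed.

Lemma tnth_cat_rshift (U : Type) n j (x : n.-tuple U) (y : j.-tuple U) i :
  tnth [tuple of x ++ y] (rshift n i) = tnth y i.
Proof. exact: tnth_rshift. Qed.

Scheme is_Sigma_mut := Minimality for is_Sigma Sort Prop
  with is_Pi_mut := Minimality for is_Pi Sort Prop.
Combined Scheme is_Sigma_Pi_ind from is_Sigma_mut, is_Pi_mut.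

Lemma tree_orbit_iso (T : tree) k (p : k.-tuple T) (f : T -> T) :
  automorphism (M := @expand _ (tree_structure T) k p) f <->
  tree_iso f /\ forall i, f (tnth p i) = tnth p i.
Proof.
have mapE (t : 2.-tuple T) i : tnth [tuple of map f t] i = f (tnth t i).
  by rewrite tnth_map.
split=> [[f_bij fr fc]|[[f_bij fP] fp]].
  split; last by move=> i; exact: (fc (inr i)).
  split=> // y z; have := fr tt [tuple y; z].
  by rewrite [X in X <-> _]/= !(mapE [tuple y; z]) /=.
split=> //; last by move=> [[]|i]; [exact: fp].
by move=> [] t; rewrite [X in X <-> _]/= !(mapE t); exact: fP.
Qed.

Lemma is_Sigma_inv (L : language) b n (phi : formula L n) : is_Sigma b phi ->
  (exists q, phi = Qf q) \/
  exists j (psi : forall i, formula L (n + j i)) b',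
    [/\ phi = OrEx psi, forall i, olt (b' i) b & forall i, is_Pi (b' i) (psi i)].
Proof.
case=> {b n phi} [b n q _|b n j psi b' b'b psiP]; first by left; exists q.
by right; exists j, psi, b'.
Qed.

Section Transfer.
Variables (m : nat) (T : tree) (typ : T -> ncard).
Hypothesis typT : typing m typ.
Variables (k : nat) (p : k.-tuple T).
Let M := @expand _ (tree_structure T) k p.

(** The parameters are matched with themselves, so that constants are
    preserved. *)
Definition tuple_match a n (s : seq (T * T)) (x y : n.-tuple T) : Prop :=
  [/\ matching (fun u v => List.In (u, v) s),
      forall u v, List.In (u, v) s -> pi_related m typ a u v,
      forall i, List.In (tnth x i, tnth y i) s
    & forall i, List.In (tnth p i, tnth p i) s].

Lemma tuple_match_qf a n s (x y : n.-tuple T) (q : qf _ n) :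
  tuple_match a s x y -> @qf_sat _ M n x q <-> @qf_sat _ M n y q.
Proof.
move=> [sm _ sxy sp].
have ev (t : term (expand_language tree_language k) n) :
    List.In (@eval _ M n x t, @eval _ M n y t) s.
  by case: t => [i|[[]|i]] /=; [exact: sxy|exact: sp].
elim: q => [|t u|[] t|q IH|q IHq r IHr|q IHq r IHr] //=.
- by have [_ + _] := sm; apply; exact: ev.
- by rewrite !tnth_map; apply: (matching_prec sm); exact: ev.
- by rewrite IH.
- by rewrite IHq IHr.
- by rewrite IHq IHr.
Qed.

Lemma step_tuple_match b B s n (x y : n.-tuple T) j (z : j.-tuple T) :
  step_matching m typ b B s -> size s + m.+2 * j <= B ->
  (forall i, List.In (tnth x i, tnth y i) s) ->
  (forall i, List.In (tnth p i, tnth p i) s) ->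
  exists (z' : j.-tuple T) s',
    tuple_match b s' [tuple of x ++ z] [tuple of y ++ z'].
Proof.
move=> sm sB sxy sp.
have [|s' [[sm' sok'] ss' sz]] := step_matching_adds typT (l := z) sm.
  by rewrite size_tuple.
have z'P i : exists v, List.In (tnth z i, v) s' by apply: sz; exact: in_tnth.
have [z' zz'] := boolp.choice z'P.
exists (mktuple z'), s'; split=> //.
- by move=> u v /sok'; exact: step_pi_related.
- move=> i; case: (split_ordP i) => j' ->.
    by rewrite !tnth_cat_lshift; exact: ss'.
  by rewrite !tnth_cat_rshift tnth_mktuple.
- by move=> i; exact: ss'.
Qed.

(** To answer [z] on the side of [y] the matching is reversed, and it stays
    reversed: the relation at [a] has the opposite direction. *)
Lemma tuple_match_extend a n s (x y : n.-tuple T) j (z : j.-tuple T) :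
  tuple_match a.+1 s x y -> exists (z' : j.-tuple T) s',
    tuple_match a s' [tuple of y ++ z] [tuple of x ++ z'].
Proof.
move=> [sm sok sxy sp].
apply: (@step_tuple_match a (size s + m.+2 * j) (swap_pairs s)).
- split=> [|u v /in_swap vu].
    exact: matching_swap_pairs.
  by apply: pi_step_related (sok _ _ vu); exact: matching_lev sm vu.
- by rewrite size_map.
- by move=> i; apply/in_swap.
- by move=> i; apply/in_swap.
Qed.

(** The usual induction: a Pi formula of level [a] passes from [x] to [y]
    because any [z] added to [y] is answered by some [z'] added to [x], with
    the longer tuples related at level [a-1] in the opposite direction. *)
Lemma transfer :
  (forall b n (phi : formula (expand_language tree_language k) n),
     is_Sigma b phi -> forall a s (x y : n.-tuple T),
       ole b (onat a) -> tuple_match a s x y ->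
       @sat _ M n phi y -> @sat _ M n phi x) /\
  (forall b n (phi : formula (expand_language tree_language k) n),
     is_Pi b phi -> forall a s (x y : n.-tuple T),
       ole b (onat a) -> tuple_match a s x y ->
       @sat _ M n phi x -> @sat _ M n phi y).
Proof.
apply: is_Sigma_Pi_ind =>
  [b n q _ a s x y _ xy|b n j psi b' b'b _ IH a s x y ba xy
  |b n q _ a s x y _ xy|b n j psi b' b'b _ IH a s x y ba xy] /=.
- exact: (tuple_match_qf q xy).2.
- move=> [i [z xz]]; have := olt_le_trans (b'b i) ba.
  case: a ba xy => [|a] ba xy; first by move=> /olt_onat.
  move=> /olt_onatS ia; have [z' [s' yz]] := tuple_match_extend z xy.
  by exists i, z'; exact: IH ia yz xz.
- exact: (tuple_match_qf q xy).1.
- move=> sx i z; have := olt_le_trans (b'b i) ba.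
  case: a ba xy => [|a] ba xy; first by move=> /olt_onat.
  move=> /olt_onatS ia; have [z' [s' yz]] := tuple_match_extend z xy.
  exact: IH ia yz (sx i z').
Qed.

Hypothesis m0 : 0 < m.

(** Only the length of the witness [z] has to be known before [x'] is chosen,
    so the type of [x'] can be taken large enough for the whole extension. *)
Lemma orbit_not_Sigma b : ole b (onat (2 * m)) -> ~ orbits_definable M b.
Proof.
move=> b2m def.
have [l [pl lP]] := down_closure (tree_root :: p).
have rl : List.In tree_root l by apply: pl; left.
have ppl i : List.In (tnth p i) l by apply: pl; right; exact: in_tnth.
have [x [rx xO] xl] : exists2 x : T,
    covers prec tree_root x /\ typ x = Omega & ~ List.In x l.
  apply: infinite_avoids; have := typ_omega typT (x := tree_root).
  by rewrite lev_root (typ_root typT) => /(_ isT).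
have newx B : exists x' : T,
    [/\ covers prec tree_root x', typ x' = Fin B & ~ List.In x' l].
  have := typ_fin typT (x := tree_root); rewrite lev_root => /(_ m0 B).
  by move=> /(infinite_avoids l) [x' [rx' x'B] x'l]; exists x'.
have hx : height m x = m by rewrite /height (covers_lev rx) lev_root; lia.
have start B x' :
    covers prec tree_root x' -> typ x' = Fin B -> ~ List.In x' l ->
    step_matching m typ (2 * m).-1 B ((x, x') :: [seq (u, u) | u <- l]).
  move=> rx' x'B x'l.
  have idP u v : List.In (u, v) [seq (u, u) | u <- l] -> u = v /\ List.In u l.
    by rewrite List.in_map_iff => -[a [[<- <-]]].
  split.
    apply: (@matching_cons _ _ tree_root tree_root) => //.
    - exact: identity_matching.
    - by apply/List.in_map_iff; exists tree_root.
    - by move=> v /idP[].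
    - by move=> u /idP[] ->.
  move=> u v /= [[<- <-]|/idP[<- _]]; last by constructor 1.
  by constructor 4; rewrite hx x'B; split=> //=; lia.
have pin x' i : List.In (tnth p i, tnth p i) ((x, x') :: [seq (u, u) | u <- l]).
  by right; apply/List.in_map_iff; exists (tnth p i).
have xin x' (i : 'I_1) : List.In (tnth [tuple x] i, tnth [tuple x'] i)
    ((x, x') :: [seq (u, u) | u <- l]).
  by left; rewrite !(tnth_nth x) (ord1 i).
have not_orbit x' B : typ x' = Fin B -> ~ @aut_orbit _ M 1 [tuple x] [tuple x'].
  move=> x'B [f /tree_orbit_iso[fi _] /(congr1 (fun t => tnth t ord0))].
  rewrite tnth_map !(tnth_nth x) /= => x'f.
  by have := typ_iso typT x fi; rewrite -x'f x'B xO.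
have [phi phiS phiP] := def 1 [tuple x].
have phix : @sat _ M 1 phi [tuple x].
  apply/phiP; exists id; last by apply: eq_from_tnth => i; rewrite tnth_map.
  by apply/tree_orbit_iso; split=> //; split=> //; exists id.
have [[q phiq]|[j [psi [b' [phipsi b'b psiP]]]]] := is_Sigma_inv phiS.
  (* A quantifier-free formula has no witness, and any finite type will do. *)
  have [x' [rx' x'B x'l]] := newx 0; apply: (not_orbit _ _ x'B); apply/phiP.
  have [sm sok] := start 0 x' rx' x'B x'l.
  move: phix; rewrite phiq; apply: (@tuple_match_qf (2 * m).-1 _ _ _ _ q _).1.
  split=> [|u v /sok||]; [exact: sm|exact: step_pi_related|exact: xin|exact: pin].
move: phix; rewrite phipsi /= => -[i [z xz]].
have [x' [rx' x'B x'l]] := newx ((size l).+1 + m.+2 * j i).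
apply: (not_orbit _ _ x'B); apply/phiP; rewrite phipsi /=.
have [|z' [s' zz']] :=
  step_tuple_match z (start _ _ rx' x'B x'l) _ (xin x') (pin x').
  by rewrite /= size_map.
exists i, z'; apply: (transfer.2 _ _ _ (psiP i)) zz' xz.
apply/olt_onatS; rewrite prednK ?muln_gt0 //.
exact: olt_le_trans (b'b i) b2m.
Qed.

End Transfer.

(** * Definable sets of tuples *)

Section Definability.
Variables (L : language) (M : structure L).

(** Definability by a Sigma_a formula for finite [a], without the formulas:
    closure properties become statements about sets, and no renaming of
    variables in infinitary formulas is needed.  The Pi_a sets are the
    complements, so one recursion suffices. *)
Fixpoint Sdef a n (X : set (n.-tuple M)) : Prop :=
  match a with
  | 0 => exists q : qf L n, forall x, X x <-> qf_sat x q
  | a'.+1 => exists D : nat -> {k : nat & set ((n + k).-tuple M)},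
      (forall i, Sdef a' (~` projT2 (D i))) /\
      forall x, X x <->
        exists i (y : (projT1 (D i)).-tuple M), projT2 (D i) [tuple of x ++ y]
  end.

Definition Pdef a n (X : set (n.-tuple M)) : Prop := Sdef a (~` X).

(** The two conclusions feed each other in the induction. *)
Lemma Sdef_formulas a n (X : set (n.-tuple M)) : Sdef a X ->
  Sigma_definable (onat a) X /\
  exists2 phi : formula L n, is_Pi (onat a) phi & forall x, sat phi x <-> ~ X x.
Proof.
elim: a n X => [|a IH] n X.
  move=> [q Xq]; have z0 : oeq (onat 0) (onat 0) by split=> -[].
  split; first by exists (Qf q) => [|x]; [exact: Sigma_qf|rewrite Xq].
  by exists (Qf (QNot q)) => [|x] /=; [exact: Pi_qf|rewrite Xq].
move=> [D [DP XD]]; split.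
  pose phi i := projT1 (cid2 (IH _ _ (DP i)).2).
  have phiP i : is_Pi (onat a) (phi i) /\
      forall x, sat (phi i) x <-> projT2 (D i) x.
    rewrite /phi; case: cid2 => /= f fP fE; split=> // x.
    by rewrite fE; split=> [nn|Yx nYx]; [exact: contrapT|exact: nYx].
  exists (OrEx phi) => [|x].
    apply: (@Sigma_or _ _ _ _ _ (fun=> onat a)) => i; last by case: (phiP i).
    exact/olt_onatS/ole_onat_refl.
  by rewrite XD /=; split=> -[i [y /((phiP i).2)]]; exists i, y.
pose phi i := projT1 (cid2 (IH _ _ (DP i)).1).
have phiP i : is_Sigma (onat a) (phi i) /\
    forall x, sat (phi i) x <-> ~ projT2 (D i) x.
  by rewrite /phi; case: cid2.
exists (AndAll phi) => [|x].
  apply: (@Pi_and _ _ _ _ _ (fun=> onat a)) => i; last by case: (phiP i).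
  exact/olt_onatS/ole_onat_refl.
rewrite XD /=; split=> [H [i [y Dy]]|H i y].
  exact: ((phiP i).2 _).1 (H i y) Dy.
by apply/(phiP i).2 => Dy; apply: H; exists i, y.
Qed.

Lemma Sdef_eq a n (X Y : set (n.-tuple M)) :
  (forall x, X x <-> Y x) -> Sdef a X -> Sdef a Y.
Proof. by move=> XY; have -> : X = Y by apply/seteqP; split=> x /XY. Qed.

Lemma Pdef_eq a n (X Y : set (n.-tuple M)) :
  (forall x, X x <-> Y x) -> Pdef a X -> Pdef a Y.
Proof. by move=> XY; apply: Sdef_eq => x; rewrite /setC /= XY. Qed.

Lemma Sdef_setC a n (X : set (n.-tuple M)) : Sdef a X -> Pdef a (~` X).
Proof. by rewrite /Pdef setCK. Qed.

Definition sel n n' (f : 'I_n -> 'I_n') (x : n'.-tuple M) : n.-tuple M :=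
  [tuple tnth x (f i) | i < n].

Definition term_sel n n' (f : 'I_n -> 'I_n') (t : term L n) : term L n' :=
  match t with Var i => Var (f i) | Cst c => Cst c end.

Fixpoint qf_sel n n' (f : 'I_n -> 'I_n') (q : qf L n) : qf L n' :=
  match q with
  | QTrue => QTrue
  | QEq s t => QEq (term_sel f s) (term_sel f t)
  | QRel r t => QRel [tuple of map (term_sel f) t]
  | QNot q => QNot (qf_sel f q)
  | QAnd q r => QAnd (qf_sel f q) (qf_sel f r)
  | QOr q r => QOr (qf_sel f q) (qf_sel f r)
  end.

Lemma qf_sel_sat n n' (f : 'I_n -> 'I_n') q (x : n'.-tuple M) :
  qf_sat x (qf_sel f q) <-> qf_sat (sel f x) q.
Proof.
have ev t : eval x (term_sel f t) = eval (sel f x) t.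
  by case: t => //= i; rewrite tnth_mktuple.
elim: q => [|s t|r t|q IH|q IHq r IHr|q IHq r IHr] //=.
- by rewrite !ev.
- suff -> : [tuple of map (eval x) [tuple of map (term_sel f) t]] =
      [tuple of map (eval (sel f x)) t] by [].
  by apply: eq_from_tnth => i; rewrite !tnth_map ev.
- by rewrite IH.
- by rewrite IHq IHr.
- by rewrite IHq IHr.
Qed.

Definition lift_sel n n' k (f : 'I_n -> 'I_n') (i : 'I_(n + k)) : 'I_(n' + k) :=
  match fintype.split i with inl j => lshift k (f j) | inr j => rshift n' j end.

Lemma sel_cat n n' k (f : 'I_n -> 'I_n') (x : n'.-tuple M) (y : k.-tuple M) :
  sel (@lift_sel n n' k f) [tuple of x ++ y] = [tuple of sel f x ++ y].
Proof.
apply: eq_from_tnth => i; rewrite tnth_mktuple /lift_sel.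
case: (split_ordP i) => j ->.
  by rewrite !tnth_cat_lshift tnth_mktuple.
by rewrite !tnth_cat_rshift.
Qed.

Lemma Sdef_sel a n n' (f : 'I_n -> 'I_n') (X : set (n.-tuple M)) :
  Sdef a X -> Sdef a [set x | X (sel f x)].
Proof.
elim: a n n' f X => [|a IH] n n' f X /=.
  by move=> [q Xq]; exists (qf_sel f q) => x; rewrite qf_sel_sat Xq.
move=> [D [DP XD]].
exists (fun i => existT _ (projT1 (D i))
  [set w | projT2 (D i) (sel (@lift_sel n n' _ f) w)]); split=> [i|x] /=.
  by apply: Sdef_eq (IH _ _ (@lift_sel n n' _ f) _ (DP i)).
by rewrite XD; split=> -[i [y xy]]; exists i, y; move: xy; rewrite sel_cat.
Qed.

Lemma Sdef_ex a n k (Y : set ((n + k).-tuple M)) :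
  Pdef a Y ->
  Sdef a.+1 [set x : n.-tuple M | exists y : k.-tuple M, Y [tuple of x ++ y]].
Proof.
move=> PY; exists (fun=> existT _ k Y); split=> // x /=.
by split=> [[y xy]|[_ [y xy]]]; [exists 0, y|exists y].
Qed.

Lemma Pdef_Sdef a n (X : set (n.-tuple M)) : Pdef a X -> Sdef a.+1 X.
Proof.
move=> PX.
have /Sdef_ex : Pdef a [set w : (n + 0).-tuple M | X (sel (@lshift n 0) w)].
  exact: (Sdef_sel (@lshift n 0) PX).
apply: Sdef_eq => x /=.
have selE (y : 0.-tuple M) : sel (@lshift n 0) [tuple of x ++ y] = x.
  by apply: eq_from_tnth => i; rewrite tnth_mktuple tnth_cat_lshift.
by split=> [[y]|Xx]; [|exists [tuple]]; rewrite selE.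
Qed.

Lemma SdefS a n (X : set (n.-tuple M)) : Sdef a X -> Sdef a.+1 X.
Proof.
elim: a n X => [|a IH] n X.
  move=> [q Xq]; apply: Pdef_Sdef; exists (QNot q) => x.
  by rewrite /setC /= Xq.
by move=> [D [DP XD]]; exists D; split=> [i|//]; exact: IH (DP i).
Qed.

Lemma Sdef_le a b n (X : set (n.-tuple M)) : a <= b -> Sdef a X -> Sdef b X.
Proof.
move=> /subnK <-; elim: (b - a) => //= c IH /IH; exact: SdefS.
Qed.

Lemma Pdef_le a b n (X : set (n.-tuple M)) : a <= b -> Pdef a X -> Pdef b X.
Proof. exact: Sdef_le. Qed.

Lemma Sdef_Pdef a b n (X : set (n.-tuple M)) : a < b -> Sdef a X -> Pdef b X.
Proof. by move=> ab /Sdef_setC/Pdef_Sdef; exact: Sdef_le. Qed.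

Lemma Sdef0_setC n (X : set (n.-tuple M)) : Sdef 0 X -> Sdef 0 (~` X).
Proof. by move=> [q Xq]; exists (QNot q) => x; rewrite /setC /= Xq. Qed.

Lemma Sdef0_Pdef a n (X : set (n.-tuple M)) : Sdef 0 X -> Pdef a X.
Proof. by move=> /Sdef0_setC; exact: Sdef_le. Qed.

Lemma Sdef_const a n (P : Prop) : Sdef a [set _ : n.-tuple M | P].
Proof.
apply: (@Sdef_le 0) => //; have [p|np] := pselect P.
  by exists QTrue.
by exists (QNot QTrue) => x; split=> [/np|[]].
Qed.

Lemma Pdef_const a n (P : Prop) : Pdef a [set _ : n.-tuple M | P].
Proof. exact: (Sdef_const _ _ (~ P)). Qed.

Lemma Sdef_bigcup a n (I : countType) (X : I -> set (n.-tuple M)) :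
  (forall i, Sdef a.+1 (X i)) -> Sdef a.+1 [set x | exists i, X i x].
Proof.
move=> SX; have [D DP] := boolp.choice SX.
pose E c : {k : nat & set ((n + k).-tuple M)} :=
  if unpickle c is Some (i, j) then D i j else existT _ 0 set0.
exists E; split=> [c|x].
  rewrite /E; case: unpickle => [[i j]|]; first exact: (DP i).1.
  exact: (Sdef_const a _ (~ False)).
split=> [[i /(DP i).2[j [y xy]]]|[c]].
  by exists (pickle (i, j)); rewrite /E pickleK; exists y.
rewrite /E; case: unpickle => [[i j]|] [y xy] //.
by exists i; apply/(DP i).2; exists j, y.
Qed.

Lemma Pdef_bigcap a n (I : countType) (X : I -> set (n.-tuple M)) :
  (forall i, Pdef a.+1 (X i)) -> Pdef a.+1 [set x | forall i, X i x].
Proof.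
move=> /Sdef_bigcup; apply: Sdef_eq => x; rewrite /setC /=.
by split=> [[i nX] /(_ i)|/existsNP].
Qed.

(** Finite intersections are treated apart from countable ones because only
    they exist at level [0], where one quantifier-free formula must do. *)
Lemma Pdef_forall a n (I : finType) (X : I -> set (n.-tuple M)) :
  (forall i, Pdef a (X i)) -> Pdef a [set x | forall i, X i x].
Proof.
case: a => [|a]; last exact: Pdef_bigcap.
move=> SX; have [q qP] := boolp.choice SX.
exists (foldr (fun i r => QOr (q i) r) (QNot QTrue) (enum I)) => x.
have -> : qf_sat x (foldr (fun i r => QOr (q i) r) (QNot QTrue) (enum I)) <->
    exists2 i, i \in enum I & ~ X i x.
  elim: (enum I) => [|i s IH] /=; first by split=> [nT|[]//]; case: nT.
  rewrite IH -qP; split=> [[iX|[j js jX]]|[j]].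
  - by exists i; rewrite ?mem_head.
  - by exists j; rewrite // in_cons js orbT.
  - by rewrite in_cons => /predU1P[-> iX|js jX]; [left|right; exists j].
rewrite /setC /=; split=> [/existsNP[i iX]|[i _ iX] /(_ i)//].
by exists i; rewrite ?mem_enum.
Qed.

Lemma Pdef_and a n (X Y : set (n.-tuple M)) :
  Pdef a X -> Pdef a Y -> Pdef a [set x | X x /\ Y x].
Proof.
move=> PX PY.
have : Pdef a [set x | forall b : bool, (if b then X else Y) x].
  by apply: Pdef_forall => -[].
apply: Pdef_eq => x /=; split=> [H|[Xx Yx] []] //.
by split; [exact: (H true)|exact: (H false)].
Qed.

Lemma Pdef_iff a n (X : set (n.-tuple M)) (P : Prop) :
  Sdef a X -> Pdef a X -> Pdef a [set x | X x <-> P].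
Proof.
move=> SX PX; have [p|np] := pselect P.
  by apply: Pdef_eq PX => x /=; tauto.
by apply: Pdef_eq (Sdef_setC SX) => x; rewrite /setC /=; tauto.
Qed.

Lemma Sdef_eq_var n (i j : 'I_n) :
  Sdef 0 [set x : n.-tuple M | tnth x i = tnth x j].
Proof. by exists (QEq (Var i) (Var j)). Qed.

Lemma Sdef_count a (R : M -> M -> Prop) k n (i : 'I_n) :
  (forall n' (j l : 'I_n'),
    Pdef a [set x : n'.-tuple M | R (tnth x j) (tnth x l)]) ->
  Sdef a.+1 [set x : n.-tuple M | `I_k #<= [set y | R (tnth x i) y]].
Proof.
move=> PR.
have : Sdef a.+1 [set x : n.-tuple M | exists y : k.-tuple M,
    (forall j, R (tnth [tuple of x ++ y] (lshift k i))
                 (tnth [tuple of x ++ y] (rshift n j))) /\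
    forall jl : 'I_k * 'I_k, tnth [tuple of x ++ y] (rshift n jl.1) =
      tnth [tuple of x ++ y] (rshift n jl.2) <-> jl.1 = jl.2].
  apply: (Sdef_ex (Y := [set w : (n + k).-tuple M |
    (forall j : 'I_k, R (tnth w (lshift k i)) (tnth w (rshift n j))) /\
    forall jl : 'I_k * 'I_k,
      tnth w (rshift n jl.1) = tnth w (rshift n jl.2) <-> jl.1 = jl.2])).
  apply: (Pdef_and (X := [set w | _]) (Y := [set w | _])).
    by apply: (Pdef_forall (X := fun j => [set w | _])) => j; exact: PR.
  apply: (Pdef_forall (X := fun jl => [set w | _])) => jl.
  apply: (Pdef_iff (X := [set w | _])).
    by apply: (@Sdef_le 0) => //; exact: Sdef_eq_var.
  by apply: Sdef0_Pdef; exact: Sdef_eq_var.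
apply: Sdef_eq => x /=; rewrite card_le_enum.
split=> [[y [yR yinj]]|[f f_inj fR]].
  exists (tnth y) => [j l yjl|j].
    by apply: (yinj (j, l)).1; rewrite /= !tnth_cat_rshift.
  by have := yR j; rewrite tnth_cat_lshift tnth_cat_rshift.
exists (mktuple f); split=> [j|[j l]] /=.
  by rewrite tnth_cat_lshift tnth_cat_rshift tnth_mktuple; exact: fR.
by rewrite !tnth_cat_rshift !tnth_mktuple; split=> [/f_inj|->].
Qed.

End Definability.

(** * Definability of the orbits *)

Section Upper.
Variables (m : nat) (T : tree) (typ : T -> ncard).
Hypothesis typT : typing m typ.
Let M := @expand _ (tree_structure T) 0 [tuple].

Lemma Sdef_prec n (i j : 'I_n) :
  @Sdef _ M 0 n [set x | @prec T (tnth x i) (tnth x j)].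
Proof.
exists (@QRel (expand_language tree_language 0) n tt [tuple Var i; Var j]) => x.
by rewrite /= !tnth_map.
Qed.

Lemma Sdef_lev_ge l n (i : 'I_n) :
  @Sdef _ M 1 n [set x | l <= @lev T (tnth x i)].
Proof.
have : @Sdef _ M 1 n [set x | `I_l #<= [set y : T | prec y (tnth x i)]].
  apply: (@Sdef_count _ M 0 (fun x y => @prec T y x)) => n' j k.
  exact/Sdef0_Pdef/Sdef_prec.
by apply: Sdef_eq => x /=; rewrite (card_le_eqr (lev_card _)) card_le_II.
Qed.

(** Free of conditions for [n = 0]: everything above a node of height [1] has
    height [0], so counting needs no restriction there and is Sigma_1. *)
Definition infinite_type n (x : T) : Prop :=
  n = 0 \/ lev x + n = m.+1 /\ typ x = Omega.

(** Above a node of height [n+1] every node satisfying [infinite_type n] has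
    the next level, and so is a child. *)
Lemma infinite_type_above n x : lev x + n.+1 = m.+1 ->
  [set y | prec x y /\ infinite_type n y] =
  [set y | covers prec x y /\ typ y = Omega].
Proof.
move=> xn; apply/seteqP; split=> y /= [xy yn]; last first.
  have := covers_lev xy; split; first exact: xy.1.
  by right; split=> //; lia.
have := prec_lev xy; have := typ_lev typT y => ym xly.
case: yn => [n0|[yn yO]].
  have ly : lev y = m.+1 by lia.
  by split; [apply: lev_coversP => //; lia|exact: (typ_leaf typT)].
by split=> //; apply: lev_coversP => //; lia.
Qed.

Lemma infinite_type_count n k x : lev x + n.+1 = m.+1 ->
  `I_k #<= [set y | prec x y /\ infinite_type n y] <-> ncle (Fin k) (typ x).
Proof.
move=> xn; rewrite infinite_type_above //; apply: has_card_ge.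
by apply: (typ_omega typT); lia.
Qed.

Lemma infinite_typeS n x : n <= m ->
  infinite_type n.+1 x <-> m - n <= lev x /\ ~ (m - n).+1 <= lev x /\
    forall k, `I_k #<= [set y | prec x y /\ infinite_type n y].
Proof.
move=> nm; split=> [[//|[xl xO]]|[xm [/negP]]].
  split; [lia|split; [lia|move=> k]].
  by apply/(infinite_type_count _ xl); rewrite xO.
rewrite -leqNgt => xm' xk; have xl : lev x + n.+1 = m.+1 by lia.
right; split=> //; apply: ncle_inj => k; split=> // _.
exact/(infinite_type_count _ xl).
Qed.

Lemma Sdef_count_infinite a n k :
  (forall n' (i : 'I_n'), @Pdef _ M a n' [set x | infinite_type n (tnth x i)]) ->
  forall n' (i : 'I_n'), @Sdef _ M a.+1 n'
    [set x | `I_k #<= [set y | @prec T (tnth x i) y /\ infinite_type n y]].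
Proof.
move=> Pn n' i.
apply: (@Sdef_count _ M _ (fun x y => @prec T x y /\ infinite_type n y)) => n1 j l.
apply: (Pdef_and (X := [set x | _]) (Y := [set x | _])); last exact: Pn.
exact/Sdef0_Pdef/Sdef_prec.
Qed.

(** Each height costs two quantifier alternations: one to count the children
    up to a given finite number, one to say that all finite numbers are
    reached.  The level of a node is a Boolean combination of Sigma_1
    conditions. *)
Lemma Pdef_infinite_type n : n <= m.+1 -> forall n' (i : 'I_n'),
  @Pdef _ M (2 * n) n' [set x | infinite_type n (tnth x i)].
Proof.
elim: n => [|n IH] nm n' i.
  by apply: (Pdef_eq _ (Pdef_const M 0 n' True)) => x /=; split=> // _; left.
have n2 : 2 * n.+1 = (2 * n).+2 by lia.
have Pcount k : @Pdef _ M (2 * n).+2 n'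
    [set x | `I_k #<= [set y | @prec T (tnth x i) y /\ infinite_type n y]].
  apply: (@Sdef_Pdef _ _ (2 * n).+1) => //; apply: Sdef_count_infinite.
  by apply: IH; lia.
have Plev : @Pdef _ M (2 * n).+2 n' [set x | m - n <= @lev T (tnth x i)].
  by apply: (@Sdef_Pdef _ _ 1) => //; exact: Sdef_lev_ge.
have Plev' : @Pdef _ M (2 * n).+2 n'
    (~` [set x | (m - n).+1 <= @lev T (tnth x i)]).
  by apply: (@Pdef_le _ _ 1) => //; apply: Sdef_setC; exact: Sdef_lev_ge.
rewrite n2.
apply: Pdef_eq (Pdef_and Plev (Pdef_and Plev' (Pdef_bigcap Pcount))) => x.
exact: (iff_sym (@infinite_typeS n (tnth x i) nm)).
Qed.

(** For [N] finite this uses both a Sigma_(2n+1) condition and the negation of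
    one; it is Pi_(2m) because [n < m]. *)
Lemma Pdef_typ n N n' (i : 'I_n') : n < m ->
  @Pdef _ M (2 * m) n' [set x | forall k,
    `I_k #<= [set y | @prec T (tnth x i) y /\ infinite_type n y] <->
    ncle (Fin k) N].
Proof.
move=> nm; have m2 : 2 * m = (2 * m).-1.+1 by lia.
rewrite m2; apply: (Pdef_bigcap (X := fun k => [set x | _])) => k; rewrite -m2.
have Scount : @Sdef _ M (2 * n).+1 n'
    [set x | `I_k #<= [set y | @prec T (tnth x i) y /\ infinite_type n y]].
  by apply/Sdef_count_infinite/Pdef_infinite_type; lia.
apply: Pdef_iff; first by apply: Sdef_le Scount; lia.
by apply: Sdef_Pdef Scount; lia.
Qed.

(** The Pi_(2m) description of the orbit of [e], for [e] closed under
    predecessors and containing the root.  The fourth clause says that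
    [tnth w i] has the type of [tnth e i], in terms of definable sets; it
    leaves out nodes of height [0] and the root, whose types are fixed. *)
Definition same_diagram n (e w : n.-tuple T) : Prop :=
  [/\ forall ij : 'I_n * 'I_n,
        tnth w ij.1 = tnth w ij.2 <-> tnth e ij.1 = tnth e ij.2,
      forall ij : 'I_n * 'I_n,
        prec (tnth w ij.1) (tnth w ij.2) <-> prec (tnth e ij.1) (tnth e ij.2),
      forall i z, prec z (tnth w i) -> exists j, z = tnth w j
    & forall i h, h < m -> lev (tnth e i) + h.+1 = m.+1 -> forall k,
        `I_k #<= [set y | prec (tnth w i) y /\ infinite_type h y] <->
        ncle (Fin k) (typ (tnth e i))].

Hypothesis m0 : 0 < m.

Lemma Pdef_same_diagram n (e : n.-tuple T) :
  @Pdef _ M (2 * m) n [set w | same_diagram e w].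
Proof.
have m1 : 1 < 2 * m by lia.
have P1 : @Pdef _ M (2 * m) n [set w : n.-tuple T | forall ij : 'I_n * 'I_n,
    tnth w ij.1 = tnth w ij.2 <-> tnth e ij.1 = tnth e ij.2].
  apply: (Pdef_forall (X := fun ij => [set w : n.-tuple M | _])) => ij.
  have S0 := Sdef_eq_var M ij.1 ij.2.
  by apply: Pdef_iff; [apply: Sdef_le S0|apply: Sdef0_Pdef].
have P2 : @Pdef _ M (2 * m) n [set w : n.-tuple T | forall ij : 'I_n * 'I_n,
    prec (tnth w ij.1) (tnth w ij.2) <-> prec (tnth e ij.1) (tnth e ij.2)].
  apply: (Pdef_forall (X := fun ij => [set w : n.-tuple M | _])) => ij.
  have S0 := Sdef_prec ij.1 ij.2.
  by apply: Pdef_iff; [apply: Sdef_le S0|apply: Sdef0_Pdef].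
have P3 : @Pdef _ M (2 * m) n [set w : n.-tuple T | forall i z,
    prec z (tnth w i) -> exists j, z = tnth w j].
  apply: (Pdef_forall (X := fun i => [set w : n.-tuple M | _])) => i.
  apply: (@Pdef_le _ _ 1); first by lia.
  have : @Sdef _ M 1 n [set w : n.-tuple M | exists z : 1.-tuple M,
      [set v : (n + 1).-tuple M |
        @prec T (tnth v (rshift n ord0)) (tnth v (lshift 1 i)) /\
        forall j, tnth v (rshift n ord0) = tnth v (lshift 1 j) <-> False]
      [tuple of w ++ z]].
    apply: Sdef_ex; apply: (Pdef_and (X := [set v | _]) (Y := [set v | _])).
      exact/Sdef0_Pdef/Sdef_prec.
    apply: (Pdef_forall (X := fun j => [set v : (n + 1).-tuple M | _])) => j.
    by apply: Pdef_iff; [|apply: Sdef0_Pdef]; exact: Sdef_eq_var.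
  apply: Sdef_eq => w; rewrite /setC /=; split=> [[z]|].
    rewrite tnth_cat_rshift tnth_cat_lshift => -[zw nz] /(_ _ zw)[j zj].
    by apply: (nz j).1; rewrite tnth_cat_lshift.
  move=> /existsNP[z /not_implyP[zw nz]]; exists [tuple z].
  rewrite tnth_cat_rshift tnth_cat_lshift; split=> // j.
  by split=> // zj; apply: nz; exists j; move: zj; rewrite tnth_cat_lshift.
have P4 : @Pdef _ M (2 * m) n [set w : n.-tuple T | forall i, forall h : 'I_m,
    lev (tnth e i) + h.+1 = m.+1 -> forall k,
        `I_k #<= [set y | prec (tnth w i) y /\ infinite_type h y] <->
        ncle (Fin k) (typ (tnth e i))].
  apply: (Pdef_forall (X := fun i => [set w : n.-tuple M | _])) => i.
  apply: (Pdef_forall (X := fun h : 'I_m => [set w : n.-tuple M | _])) => h.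
  have [ei|nei] := pselect (lev (tnth e i) + h.+1 = m.+1).
    apply: Pdef_eq (Pdef_typ (typ (tnth e i)) i (ltn_ord h)) => x /=.
    by split=> [H _|/(_ ei)].
  by apply: Pdef_eq (Pdef_const M _ _ True) => x /=.
apply: Pdef_eq (Pdef_and (Pdef_and P1 P2) (Pdef_and P3 P4)) => w /=.
split=> [[[H1 H2] [H3 H4]]|[H1 H2 H3 H4]].
  by split=> // i h hm; exact: (H4 i (Ordinal hm)).
by do 2!split=> //; move=> i h; exact: H4.
Qed.

Lemma same_diagram_iso n (e w : n.-tuple T) :
  (exists i, tnth e i = tree_root) ->
  (forall i z, prec z (tnth e i) -> exists j, z = tnth e j) ->
  same_diagram e w ->
  exists2 f : T -> T, tree_iso f & forall i, f (tnth e i) = tnth w i.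
Proof.
move=> [r er] e_closed [weq wprec w_closed wtyp].
pose s := [seq (tnth e i, tnth w i) | i <- enum 'I_n].
have sP u v : List.In (u, v) s <-> exists i, u = tnth e i /\ v = tnth w i.
  rewrite List.in_map_iff; split=> [[i [[<- <-] _]]|[i [-> ->]]].
    by exists i.
  exists i; split=> //; apply/(in_nth i); exists i; last exact: nth_ord_enum.
  by rewrite size_enum_ord.
have w_root i : tnth e i = tree_root -> tnth w i = tree_root.
  move=> ei; case: (root_least (tnth w i)) => // /[dup] h /w_closed[j rj].
  move: h; rewrite rj => /(wprec (j, i)) /=; rewrite ei.
  by move=> /prec_root.
have sm : matching (fun u v => List.In (u, v) s).
  split.
  - by apply/sP; exists r; rewrite er w_root.
  - by move=> u v u' v' /sP[i [-> ->]] /sP[j [-> ->]]; have := weq (i, j); tauto.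
  - move=> u v /sP[i [-> ->]].
    have [ei|nei] := pselect (tnth e i = tree_root).
      by left; rewrite ei w_root.
    right; have [x xi] := covers_ex nei; have [j xj] := e_closed _ _ xi.1.
    exists x, (tnth w j); split=> //; first by apply/sP; exists j.
    rewrite xj in xi; split; first exact: (wprec (j, i)).2 xi.1.
    move=> [z [jz zi]]; have [l zl] := w_closed _ _ zi; apply: xi.2.
    exists (tnth e l); split; first by apply: (wprec (j, l)).1; rewrite /= -zl.
    by apply: (wprec (l, i)).1; rewrite /= -zl.
have st : typed_matching typ s.
  split=> // u v uv; have luv := matching_lev sm uv.
  move: uv luv => /sP[i [-> ->]] luv; have lm := typ_lev typT (tnth e i).
  have [l0|lpos] := posnP (lev (tnth e i)).
    by have ei := lev0 l0; rewrite (w_root _ ei) ei.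
  have [lm1|nlm1] := eqVneq (lev (tnth e i)) m.+1.
    have wO : typ (tnth w i) = Omega by apply: (typ_leaf typT); rewrite -luv.
    by rewrite wO; exact: (typ_leaf typT).
  apply: ncle_inj => k; have lh : lev (tnth e i) + (m - lev (tnth e i)).+1 = m.+1.
    by lia.
  rewrite -(wtyp i _ _ lh); last by lia.
  by apply: infinite_type_count; rewrite -luv.
have [f fi fs] := typed_matching_iso typT st.
by exists f => // i; apply: fs; apply/sP; exists i.
Qed.

Lemma iso_same_diagram n (e : n.-tuple T) (f : T -> T) :
  (forall i z, prec z (tnth e i) -> exists j, z = tnth e j) ->
  tree_iso f -> same_diagram e [tuple of map f e].
Proof.
move=> e_closed ff; have [[g fK gK] fP] := ff; split.
- by move=> ij; rewrite !tnth_map; split=> [/(can_inj fK)|->].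
- by move=> ij; rewrite !tnth_map.
- move=> i z; rewrite tnth_map -[z]gK => /fP/e_closed[j ->].
  by exists j; rewrite tnth_map.
- move=> i h _ eh k; rewrite tnth_map -(typ_iso typT _ ff).
  by apply: infinite_type_count; rewrite iso_lev.
Qed.

(** The entries of the closure [l] are quantified away, at the cost of one
    existential block in front of the Pi_(2m) description. *)
Lemma orbits_Sigma : orbits_definable M (onat (2 * m).+1).
Proof.
move=> n a.
have [l [al l_closed]] := @down_closure T (tree_root :: a : seq T).
pose y0 : (size l).-tuple T := in_tuple l.
pose e : (n + size l).-tuple T := [tuple of (a : n.-tuple T) ++ y0].
have eE i : tnth e (lshift (size l) i) = tnth a i by rewrite tnth_cat_lshift.
have el i : List.In (tnth e i) l.
  case: (split_ordP i) => j ->; last by rewrite tnth_cat_rshift; exact: in_tnth.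
  by rewrite eE; apply: al; right; exact: in_tnth.
have le x : List.In x l -> exists i, tnth e i = x.
  move=> /(in_nth x)[i il ix]; exists (rshift n (Ordinal il)).
  by rewrite tnth_cat_rshift (tnth_nth x).
have e_closed i z : prec z (tnth e i) -> exists j, z = tnth e j.
  by move=> /(l_closed _ (el i))/le[j <-]; exists j.
have e_root : exists i, tnth e i = tree_root by apply/le/al; left.
suff : Sdef (2 * m).+1 (aut_orbit (M := M) a) by move=> /Sdef_formulas[].
apply: Sdef_eq (Sdef_ex (Pdef_same_diagram e)) => x /=; split.
  move=> [y /(same_diagram_iso e_root e_closed)[f fi fe]].
  exists f; first by apply/tree_orbit_iso; split=> // -[].
  apply: eq_from_tnth => i.
  by have := fe (lshift _ i); rewrite eE tnth_cat_lshift tnth_map.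
move=> [f /tree_orbit_iso[fi _] ->]; exists [tuple of map f y0].
have := iso_same_diagram e_closed fi.
suff -> : [tuple of map f e] =
  [tuple of [tuple of map f (a : n.-tuple T)] ++ [tuple of map f y0]] by [].
by apply: val_inj; rewrite /= map_cat.
Qed.

End Upper.

Theorem corollary7p6 (m : nat) (hm : 1 <= m) (A : tree)
    (hA : tree_type m.+1 Omega A) :
  is_pSR (tree_structure A) (onat (2 * m).+1).
Proof.
have [typ typA] := typing_ex hA.
have lower k (p : k.-tuple (tree_structure A)) b :
    orbits_definable (expand p) b -> ole (onat (2 * m).+1) b.
  move=> def; apply: contrapT => /ole_total/olt_onatS b2m.
  exact: (orbit_not_Sigma typA hm b2m def).
split=> [|k p b [def _]]; last exact: lower def.
exists 0, [tuple]; split; last by move=> b; exact: lower.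
exact: (orbits_Sigma typA hm).
Qed.
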